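(* The sets $\mathcal{A}_N$, $\mathcal{B}_N$ and $\mathcal{C}_N$ ($N\geq 1$) satisfy the following relations. (a) For all $N\geq 1$, $\mathcal{A}_{N+1}\subsetneq\mathcal{A}_N$, $\mathcal{B}_{N+1}\subsetneq\mathcal{B}_N$ and $\mathcal{C}_{N+1}\subsetneq\mathcal{C}_N$. (b) For all $N\geq 2$, $\mathcal{C}_N\subsetneq\mathcal{A}_N$ and $\bigcap_{m\geq 1}\mathcal{A}_m\nsubseteq\mathcal{C}_N$. (c) For all $N\geq 1$, $\mathcal{B}_N\subsetneq\mathcal{A}_N$ and $\bigcap_{m\geq 1}\mathcal{A}_m\nsubseteq\mathcal{B}_N$. Furthermore, $\bigcap_{m\geq 1}\mathcal{C}_m\nsubseteq\mathcal{B}_N$.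
   Context: $\mathbb{N}=\{0,1,2,\dots\}$. For $\dot{\phi}:\mathbb{N}\to\mathbb{C}$ and $j\in\{1,2\}$, $\mathfrak{d}_j\dot{\phi}(n)=\dot{\phi}(n)-\dot{\phi}(n+j)$ and $\mathfrak{d}_j^{m+1}\dot{\phi}=\mathfrak{d}_j(\mathfrak{d}_j^m\dot{\phi})$. $S_1(\ell_2(\mathbb{N}))$ is the space of trace class operators on $\ell_2(\mathbb{N})$; an infinite matrix belongs to it if it is the matrix, in the canonical basis, of a trace class operator. For each $N\geq 1$ define $$A(N,\dot{\phi})=\left((1+i+j)^{N-1}\mathfrak{d}_2^N\dot{\phi}(i+j)\right)_{i,j\in\mathbb{N}},\quad B(N,\dot{\phi})=\left((1+i+j)^{N-1}\mathfrak{d}_1^N\dot{\phi}(i+j)\right)_{i,j\in\mathbb{N}},$$ $$C(N,\dot{\phi})=\left((1+i+j)^{N-1}\mathfrak{d}_2\dot{\phi}(i+j)\right)_{i,j\in\mathbb{N}},$$ and $\mathcal{A}_N=\{\dot{\phi}\in\ell_\infty(\mathbb{N}): A(N,\dot{\phi})\in S_1(\ell_2(\mathbb{N}))\}$, $\mathcal{B}_N=\{\dot{\phi}\in\ell_\infty(\mathbb{N}): B(N,\dot{\phi})\in S_1(\ell_2(\mathbb{N}))\}$, $\mathcal{C}_N=\{\dot{\phi}\in\ell_\infty(\mathbb{N}): C(N,\dot{\phi})\in S_1(\ell_2(\mathbb{N}))\}$. *)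

(* Defs.v *)
(* Stdlib reals with Coquelicot's complex numbers. *)
From Stdlib Require Export Reals Ensembles.
From Coquelicot Require Export Coquelicot.

Open Scope R_scope.

Definition ell2 (x : nat -> C) : Prop := ex_series (fun n => Cmod (x n) ^ 2).

Definition ell2_norm (x : nat -> C) : R := sqrt (Series (fun n => Cmod (x n) ^ 2)).

(* Linear in the first variable.  Coquelicot's total [Series] is real-valued,
   hence the two components; both series converge when x and y are in ell2. *)
Definition inner (x y : nat -> C) : C :=
  (Series (fun n => Re (x n * Cconj (y n))%C),
   Series (fun n => Im (x n * Cconj (y n))%C)).

Definition basis (k : nat) : nat -> C :=
  fun n => if Nat.eqb n k then RtoC 1 else RtoC 0.

(* An operator is a total map on sequences; only its values on ell2 matter. *)
Record bounded_operator (T : (nat -> C) -> (nat -> C)) : Prop := {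
  bounded_operator_ell2 : forall x, ell2 x -> ell2 (T x);
  bounded_operator_add : forall x y, ell2 x -> ell2 y ->
    forall n, T (fun k => (x k + y k)%C) n = (T x n + T y n)%C;
  bounded_operator_scal : forall (c : C) x, ell2 x ->
    forall n, T (fun k => (c * x k)%C) n = (c * T x n)%C;
  bounded_operator_bound : exists M : R, forall x, ell2 x ->
    ell2_norm (T x) <= M * ell2_norm x
}.

Definition is_adjoint (T S : (nat -> C) -> (nat -> C)) : Prop :=
  bounded_operator S /\
  forall x y, ell2 x -> ell2 y -> inner (T x) y = inner x (S y).

Definition positive_operator (P : (nat -> C) -> (nat -> C)) : Prop :=
  bounded_operator P /\
  forall x, ell2 x -> Im (inner (P x) x) = 0 /\ 0 <= Re (inner (P x) x).

(* P = |T| = (T^* T)^{1/2}, the unique positive square root of T^* T. *)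
Definition is_absolute_value (T P : (nat -> C) -> (nat -> C)) : Prop :=
  positive_operator P /\
  exists S, is_adjoint T S /\
    forall x, ell2 x -> forall n, P (P x) n = S (T x) n.

(* Tr |T| < oo, the trace being computed in the canonical basis.  The terms
   are nonnegative reals since |T| is positive. *)
Definition trace_class (T : (nat -> C) -> (nat -> C)) : Prop :=
  bounded_operator T /\
  exists P, is_absolute_value T P /\
    ex_series (fun n => Re (inner (P (basis n)) (basis n))).

Definition matrix_of (T : (nat -> C) -> (nat -> C)) : nat -> nat -> C :=
  fun i j => inner (T (basis j)) (basis i).

Definition matrix_in_S1 (M : nat -> nat -> C) : Prop :=
  exists T, trace_class T /\ forall i j, matrix_of T i j = M i j.

Definition ell_infty (phi : nat -> C) : Prop :=
  exists M : R, forall n, Cmod (phi n) <= M.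

Definition diff (j : nat) (phi : nat -> C) : nat -> C :=
  fun n => (phi n - phi (n + j)%nat)%C.

Definition diff_iter (j m : nat) (phi : nat -> C) : nat -> C :=
  Nat.iter m (diff j) phi.

(* Only used for N >= 1, where the truncated N - 1 is the usual one. *)
Definition weight (N i j : nat) : C := RtoC (INR (1 + i + j) ^ (N - 1)).

Definition matA (N : nat) (phi : nat -> C) (i j : nat) : C :=
  (weight N i j * diff_iter 2 N phi (i + j)%nat)%C.

Definition matB (N : nat) (phi : nat -> C) (i j : nat) : C :=
  (weight N i j * diff_iter 1 N phi (i + j)%nat)%C.

Definition matC (N : nat) (phi : nat -> C) (i j : nat) : C :=
  (weight N i j * diff 2 phi (i + j)%nat)%C.

Definition setA (N : nat) : Ensemble (nat -> C) :=
  fun phi => ell_infty phi /\ matrix_in_S1 (matA N phi).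

Definition setB (N : nat) : Ensemble (nat -> C) :=
  fun phi => ell_infty phi /\ matrix_in_S1 (matB N phi).

Definition setC (N : nat) : Ensemble (nat -> C) :=
  fun phi => ell_infty phi /\ matrix_in_S1 (matC N phi).

Definition bigcap_ge1 (F : nat -> Ensemble (nat -> C)) : Ensemble (nat -> C) :=
  fun phi => forall m : nat, (1 <= m)%nat -> F m phi.

Arguments Included {U} _ _.
Arguments Strict_Included {U} _ _.

(* Main.v *)
Require Import Defs.
From Stdlib Require Import Lia Lra Psatz.
From Stdlib Require Import FunctionalExtensionality ProofIrrelevance ClassicalEpsilon.

(** All the matrices involved are Hankel matrices h(i+j), so the proposition compares conditions of
    the form: the Hankel matrix of (1+n)^M psi(n) is trace class.  The proof rests on a
    description of the trace class by duality with finite matrices.  Say that X is dominated by a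
    weight p on the indices i, j < n when
      2 |sum X_ij x_i y_j| <= sum p_i |x_i|^2 + sum p_j |y_j|^2  for all vectors x, y;
    for p = 1 this says that X is a contraction.  A matrix M is called nuclear when the sums
    |sum X_ij M_ij| are bounded uniformly over all finite contractions X.

    Nuclear and trace class are the same thing ([matrix_in_S1_iff_nuclear]).  If T has absolute
    value P, Gram-Schmidt for the form <Px,y> gives vectors f_k with
    T e_j = sum_k <P e_j, f_k> T f_k and |T f_k| = |P f_k|, while Bessel bounds sum_k |P f_k|^2 by
    Tr P; this plays the role of the polar decomposition.  Conversely a nuclear matrix defines a
    bounded operator T, the positive square root P of T^*T is the limit of an explicit iteration,
    and Gram-Schmidt for <Px,Py> exhibits each partial sum of Tr P as a limit of pairings of M
    with contractions.

    The inclusions then become estimates on weights.  Multiplying X entrywise by the kernel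
    1/(1+i+j) divides its weight by 1+2i, because this kernel is an explicit sum of positive rank
    one kernels with diagonal 1/(1+2i) ([dominated_hilbert]).  So division by 1+n and shifts
    preserve nuclear Hankel matrices, which gives C_(N+1) in C_N, C_N in A_N and B_N in A_N, since
    d_2 = d_1 (1 + shift).  The remaining inclusions need the converse direction [hankel_lift]:
    from (1+n)^(N+1) d_2 psi back to (1+n)^N psi, when psi tends to 0.  Summing
    psi(n) = sum_k d_2 psi(n+2k) amounts to testing against the sum of the diagonal shifts of X by
    k, whose weight at the index a is the number of k <= a, hence at most a+1, and this growth is
    exactly absorbed by the factor 1/(1+a+b).  That psi tends to 0 holds for psi = d_j f with f
    bounded, because nuclear Hankel matrices have absolutely summable symbols
    ([diff_vanishing]).

    Summability of the even entries also separates the sets: a Hankel symbol of size at least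
    1/(n+3) is not nuclear.  The sequence i^n / ((1+n)^N (n+3)) lies in A_N, B_N and C_N but not in
    A_(N+1), because d_2 only makes its modulus larger; hence it lies in neither B_(N+1) nor
    C_(N+1).  The sequence 1/(n+1) lies in every A_m but not in C_2, and (-1)^n, which d_2
    annihilates and d_1 doubles, lies in every A_m and C_m but in no B_N. *)

(** * Finite sums *)

Fixpoint rsum (n : nat) (f : nat -> R) : R :=
  match n with O => 0 | S k => rsum k f + f k end.

Fixpoint csum (n : nat) (f : nat -> C) : C :=
  match n with O => RtoC 0 | S k => (csum k f + f k)%C end.

Lemma rsum_ext n f g : (forall i, (i < n)%nat -> f i = g i) -> rsum n f = rsum n g.
Proof.
  induction n as [|n IH]; intros H; simpl; [reflexivity|].
  rewrite IH, H; auto.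
Qed.

Lemma csum_ext n f g : (forall i, (i < n)%nat -> f i = g i) -> csum n f = csum n g.
Proof.
  induction n as [|n IH]; intros H; simpl; [reflexivity|].
  rewrite IH, H; auto.
Qed.

Lemma rsum_le n f g : (forall i, (i < n)%nat -> f i <= g i) -> rsum n f <= rsum n g.
Proof.
  induction n as [|n IH]; intros H; simpl; [lra|].
  apply Rplus_le_compat; auto.
Qed.

Lemma rsum_0 n f : (forall i, (i < n)%nat -> f i = 0) -> rsum n f = 0.
Proof.
  induction n as [|n IH]; intros H; simpl; [reflexivity|].
  rewrite IH, H; auto; ring.
Qed.

Lemma csum_0 n f : (forall i, (i < n)%nat -> f i = RtoC 0) -> csum n f = RtoC 0.
Proof.
  induction n as [|n IH]; intros H; simpl; [reflexivity|].
  rewrite IH, H; auto; ring.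
Qed.

Lemma rsum_ge0 n f : (forall i, (i < n)%nat -> 0 <= f i) -> 0 <= rsum n f.
Proof.
  intros H. rewrite <- (rsum_0 n (fun _ => 0)); auto. now apply rsum_le.
Qed.

Lemma rsum_plus n f g : rsum n (fun i => f i + g i) = rsum n f + rsum n g.
Proof. induction n as [|n IH]; simpl; [ring | rewrite IH; ring]. Qed.

Lemma csum_plus n f g : csum n (fun i => (f i + g i)%C) = (csum n f + csum n g)%C.
Proof. induction n as [|n IH]; simpl; [ring | rewrite IH; ring]. Qed.

Lemma rsum_scal n a f : rsum n (fun i => a * f i) = a * rsum n f.
Proof. induction n as [|n IH]; simpl; [ring | rewrite IH; ring]. Qed.

Lemma csum_scal n a f : csum n (fun i => (a * f i)%C) = (a * csum n f)%C.
Proof. induction n as [|n IH]; simpl; [ring | rewrite IH; ring]. Qed.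

Lemma csum_conj n f : Cconj (csum n f) = csum n (fun i => Cconj (f i)).
Proof.
  induction n as [|n IH]; simpl; [apply injective_projections; simpl; ring|].
  now rewrite Cplus_conj, IH.
Qed.

Lemma csum_RtoC n f : csum n (fun i => RtoC (f i)) = RtoC (rsum n f).
Proof. induction n as [|n IH]; simpl; [reflexivity|]. now rewrite IH, RtoC_plus. Qed.

Lemma csum_swap n m f :
  csum n (fun i => csum m (fun j => f i j)) = csum m (fun j => csum n (fun i => f i j)).
Proof.
  induction n as [|n IH]; simpl.
  - symmetry; now apply csum_0.
  - now rewrite IH, csum_plus.
Qed.

Lemma rsum_swap n m f :
  rsum n (fun i => rsum m (fun j => f i j)) = rsum m (fun j => rsum n (fun i => f i j)).
Proof.
  induction n as [|n IH]; simpl.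
  - symmetry; now apply rsum_0.
  - now rewrite IH, rsum_plus.
Qed.

Lemma Cmod_csum n f : Cmod (csum n f) <= rsum n (fun i => Cmod (f i)).
Proof.
  induction n as [|n IH]; simpl; [rewrite Cmod_0; lra|].
  eapply Rle_trans; [apply Cmod_triangle|]. lra.
Qed.

Lemma csum_add n k f : csum (n + k) f = (csum k f + csum n (fun i => f (i + k)%nat))%C.
Proof.
  induction n as [|n IH]; simpl; [ring|]. rewrite IH; ring.
Qed.

Lemma rsum_add n k f : rsum (n + k) f = rsum k f + rsum n (fun i => f (i + k)%nat).
Proof.
  induction n as [|n IH]; simpl; [ring|]. rewrite IH; ring.
Qed.

Lemma csum_widen n N f : (n <= N)%nat ->
  (forall i, (n <= i < N)%nat -> f i = RtoC 0) -> csum N f = csum n f.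
Proof.
  intros H Hf. replace N with ((N - n) + n)%nat by lia.
  rewrite csum_add, (csum_0 (N - n)); [ring|]. intros; apply Hf; lia.
Qed.

Lemma rsum_widen n N f : (n <= N)%nat ->
  (forall i, (n <= i < N)%nat -> f i = 0) -> rsum N f = rsum n f.
Proof.
  intros H Hf. replace N with ((N - n) + n)%nat by lia.
  rewrite rsum_add, (rsum_0 (N - n)); [ring|]. intros; apply Hf; lia.
Qed.

Lemma rsum_mono n N f : (n <= N)%nat -> (forall i, 0 <= f i) -> rsum n f <= rsum N f.
Proof.
  intros H Hf. replace N with ((N - n) + n)%nat by lia. rewrite rsum_add.
  pose proof (rsum_ge0 (N - n) (fun i => f (i + n)%nat) (fun i _ => Hf _)). lra.
Qed.

Lemma csum_single n k f : (k < n)%nat -> (forall i, (i < n)%nat -> i <> k -> f i = RtoC 0) ->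
  csum n f = f k.
Proof.
  intros Hk Hf. induction n as [|n IH]; [lia|]. simpl.
  destruct (Nat.eq_dec k n) as [->|Hne].
  - rewrite csum_0; [ring|]. intros; apply Hf; lia.
  - rewrite IH, (Hf n); try lia; try ring. intros; apply Hf; lia.
Qed.

(** * Matrices dominated by a weight *)

Definition pairing (n : nat) (X M : nat -> nat -> C) : C :=
  csum n (fun i => csum n (fun j => (X i j * M i j)%C)).

Definition weighted_sq (n : nat) (p : nat -> R) (x : nat -> C) : R :=
  rsum n (fun i => p i * Cmod (x i) ^ 2).

(** The additive form of a bound by the geometric mean of two weighted norms: rescaling x and y
    shows that the two agree, and the additive form makes sums of matrices add their weights. *)
Definition dominated (n : nat) (X : nat -> nat -> C) (p : nat -> R) : Prop :=
  forall x y, 2 * Cmod (pairing n X (fun i j => (x i * y j)%C)) <= weighted_sq n p x + weighted_sq n p y.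

(** The finite dimensional form of the trace norm: the supremum of
    |sum X_ij M_ij| over finite contractions X.  It involves finite sums only and is manifestly stable under the operations
    used below. *)
Definition nuclear (M : nat -> nat -> C) : Prop :=
  exists c, forall n X, dominated n X (fun _ => 1) -> Cmod (pairing n X M) <= c.

Lemma pairing_ext n X Y M M' :
  (forall i j, (i < n)%nat -> (j < n)%nat -> (X i j * M i j = Y i j * M' i j)%C) ->
  pairing n X M = pairing n Y M'.
Proof. intros H. apply csum_ext; intros i Hi. apply csum_ext; intros j Hj. auto. Qed.

Lemma pairing_plus n X M M' :
  pairing n X (fun i j => (M i j + M' i j)%C) = (pairing n X M + pairing n X M')%C.
Proof.
  unfold pairing. rewrite <- csum_plus. apply csum_ext; intros i _.
  rewrite <- csum_plus. apply csum_ext; intros j _. ring.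
Qed.

Lemma pairing_scal n X M a :
  pairing n X (fun i j => (a * M i j)%C) = (a * pairing n X M)%C.
Proof.
  unfold pairing. rewrite <- csum_scal. apply csum_ext; intros i _.
  rewrite <- csum_scal. apply csum_ext; intros j _. ring.
Qed.

Lemma pairing_csum n X m (M : nat -> nat -> nat -> C) :
  pairing n X (fun i j => csum m (fun k => M k i j)) = csum m (fun k => pairing n X (M k)).
Proof.
  induction m as [|m IH]; simpl.
  - apply csum_0; intros; apply csum_0; intros; ring.
  - now rewrite pairing_plus, IH.
Qed.

Lemma pairing_swap n X M : pairing n X M = pairing n M X.
Proof. apply csum_ext; intros; apply csum_ext; intros; ring. Qed.

Lemma dominated_ext n X Y p : 
  (forall i j, (i < n)%nat -> (j < n)%nat -> X i j = Y i j) ->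
  dominated n X p -> dominated n Y p.
Proof.
  intros H HX x y. rewrite <- (pairing_ext n X Y (fun i j => (x i * y j)%C)); auto.
  intros; now rewrite H.
Qed.

Lemma dominated_weaken n X p q :
  (forall i, (i < n)%nat -> p i <= q i) -> dominated n X p -> dominated n X q.
Proof.
  intros H HX x y. eapply Rle_trans; [apply HX|].
  apply Rplus_le_compat; apply rsum_le; intros i Hi; apply Rmult_le_compat_r; auto;
    apply pow2_ge_0.
Qed.

Lemma dominated_plus n X Y p q :
  dominated n X p -> dominated n Y q ->
  dominated n (fun i j => (X i j + Y i j)%C) (fun i => p i + q i).
Proof.
  intros HX HY x y. specialize (HX x y). specialize (HY x y).
  rewrite pairing_swap, pairing_plus, !(pairing_swap n (fun i j => (x i * y j)%C)).
  assert (E : forall z, weighted_sq n (fun i => p i + q i) z = weighted_sq n p z + weighted_sq n q z).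
  { intros z. unfold weighted_sq. rewrite <- rsum_plus. apply rsum_ext; intros; ring. }
  rewrite !E. eapply Rle_trans; [apply Rmult_le_compat_l; [lra | apply Cmod_triangle]|]. lra.
Qed.

Lemma dominated_scal n X p (a : C) :
  dominated n X p -> dominated n (fun i j => (a * X i j)%C) (fun i => Cmod a * p i).
Proof.
  intros HX x y. specialize (HX x y).
  rewrite pairing_swap, pairing_scal, pairing_swap, Cmod_mult.
  assert (E : forall z, weighted_sq n (fun i => Cmod a * p i) z = Cmod a * weighted_sq n p z).
  { intros z. unfold weighted_sq. rewrite <- rsum_scal. apply rsum_ext; intros; ring. }
  rewrite !E. pose proof (Cmod_ge_0 a). nra.
Qed.

Lemma dominated_0 n : dominated n (fun _ _ => RtoC 0) (fun _ => 0).
Proof.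
  intros x y. unfold pairing. rewrite csum_0.
  - rewrite Cmod_0. unfold weighted_sq. rewrite !rsum_0; intros; try ring. lra.
  - intros; apply csum_0; intros; ring.
Qed.

Lemma dominated_csum n m (X : nat -> nat -> nat -> C) (p : nat -> nat -> R) :
  (forall k, (k < m)%nat -> dominated n (X k) (p k)) ->
  dominated n (fun i j => csum m (fun k => X k i j)) (fun i => rsum m (fun k => p k i)).
Proof.
  induction m as [|m IH]; intros H; simpl.
  - apply dominated_0.
  - apply dominated_plus; auto.
Qed.

(** Diagonal factors on both sides are absorbed by the test vectors. *)
Lemma dominated_diag n X p (u v : nat -> C) (w : nat -> R) :
  (forall i, 0 <= p i) ->
  (forall i, Cmod (u i) ^ 2 <= w i) -> (forall i, Cmod (v i) ^ 2 <= w i) ->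
  dominated n X p -> dominated n (fun i j => (u i * X i j * v j)%C) (fun i => w i * p i).
Proof.
  intros Hp Hu Hv HX x y.
  specialize (HX (fun i => (u i * x i)%C) (fun i => (v i * y i)%C)).
  rewrite (pairing_ext n _ X _ (fun i j => (u i * x i * (v j * y j))%C)) by (intros; ring).
  eapply Rle_trans; [apply HX|].
  assert (E : forall t z, (forall i, Cmod (t i) ^ 2 <= w i) ->
    weighted_sq n p (fun i => (t i * z i)%C) <= weighted_sq n (fun i => w i * p i) z).
  { intros t z Ht. apply rsum_le; intros i _. rewrite Cmod_mult, Rpow_mult_distr.
    specialize (Ht i). specialize (Hp i). pose proof (pow2_ge_0 (Cmod (z i))).
    assert (0 <= p i * Cmod (z i) ^ 2) by now apply Rmult_le_pos. nra. }
  apply Rplus_le_compat; auto.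
Qed.

Lemma pairing_widen n N X M : (n <= N)%nat ->
  pairing N (fun i j => if (Nat.ltb i n && Nat.ltb j n)%bool then X i j else RtoC 0) M
  = pairing n X M.
Proof.
  intros H. unfold pairing. rewrite (csum_widen n N); auto.
  - apply csum_ext; intros i Hi. rewrite (csum_widen n N); auto.
    + apply csum_ext; intros j Hj. apply Nat.ltb_lt in Hi, Hj. now rewrite Hi, Hj.
    + intros j Hj. destruct (Nat.ltb_spec j n); [lia|]. rewrite Bool.andb_false_r. ring.
  - intros i Hi. apply csum_0; intros j Hj.
    destruct (Nat.ltb_spec i n); [lia|]. simpl. ring.
Qed.

Lemma dominated_widen n N X p : (n <= N)%nat -> (forall i, 0 <= p i) -> dominated n X p ->
  dominated N (fun i j => if (Nat.ltb i n && Nat.ltb j n)%bool then X i j else RtoC 0) p.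
Proof.
  intros H Hp HX x y. rewrite pairing_widen; auto.
  eapply Rle_trans; [apply HX|]. 
  apply Rplus_le_compat; apply rsum_mono; auto; intros i; apply Rmult_le_pos; auto;
    apply pow2_ge_0.
Qed.

(** Translation by k along the diagonal, dual to M(i,j) |-> M(i+k,j+k). *)
Definition shifted (k : nat) (X : nat -> nat -> C) (a b : nat) : C :=
  if (Nat.leb k a && Nat.leb k b)%bool then X (a - k)%nat (b - k)%nat else RtoC 0.

Lemma pairing_shifted k n X M :
  pairing (n + k) (shifted k X) M = pairing n X (fun i j => M (i + k)%nat (j + k)%nat).
Proof.
  unfold pairing, shifted. rewrite csum_add, csum_0.
  - rewrite Cplus_0_l. apply csum_ext; intros i _. rewrite csum_add, csum_0.
    + rewrite Cplus_0_l. apply csum_ext; intros j _.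
      rewrite !(proj2 (Nat.leb_le _ _)) by lia. simpl. now rewrite !Nat.add_sub.
    + intros j Hj. rewrite (proj2 (Nat.leb_gt k j)) by lia. rewrite Bool.andb_false_r. ring.
  - intros i Hi. apply csum_0; intros j _. rewrite (proj2 (Nat.leb_gt k i)) by lia. simpl. ring.
Qed.

Lemma dominated_shifted k n X : dominated n X (fun _ => 1) ->
  dominated (n + k) (shifted k X) (fun a => if Nat.leb k a then 1 else 0).
Proof.
  intros HX x y. rewrite pairing_shifted.
  eapply Rle_trans; [apply (HX (fun i => x (i + k)%nat) (fun i => y (i + k)%nat))|].
  assert (E : forall z, weighted_sq (n + k) (fun a => if Nat.leb k a then 1 else 0) z =
    weighted_sq n (fun _ => 1) (fun i => z (i + k)%nat)).
  { intros z. unfold weighted_sq. rewrite rsum_add, rsum_0.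
    - rewrite Rplus_0_l. apply rsum_ext; intros i _.
      now rewrite (proj2 (Nat.leb_le _ _)) by lia.
    - intros i Hi. rewrite (proj2 (Nat.leb_gt k i)) by lia. ring. }
  rewrite !E. lra.
Qed.

(** Translation of the rows only, dual to M(i,j) |-> M(i+1,j); the columns beyond n are cleared
    because the matrix is enlarged to size n+1 in both directions. *)
Definition rowshift (n : nat) (X : nat -> nat -> C) (a b : nat) : C :=
  match a with O => RtoC 0 | S a' => if Nat.ltb b n then X a' b else RtoC 0 end.

Lemma pairing_rowshift n X M :
  pairing (n + 1) (rowshift n X) M = pairing n X (fun i j => M (i + 1)%nat j).
Proof.
  unfold pairing. rewrite csum_add. simpl csum at 1.
  rewrite csum_0 by (intros; ring). rewrite !Cplus_0_l.
  apply csum_ext; intros i _. rewrite (csum_widen n) ; [|lia|].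
  - apply csum_ext; intros j Hj. replace (i + 1)%nat with (S i) by lia. simpl.
    now rewrite (proj2 (Nat.ltb_lt _ _)) by lia.
  - intros j Hj. replace (i + 1)%nat with (S i) by lia. simpl.
    rewrite (proj2 (Nat.ltb_ge _ _)) by lia. ring.
Qed.

Lemma dominated_rowshift n X : dominated n X (fun _ => 1) ->
  dominated (n + 1) (rowshift n X) (fun _ => 1).
Proof.
  intros HX x y. rewrite pairing_rowshift.
  eapply Rle_trans; [apply (HX (fun i => x (i + 1)%nat) y)|].
  unfold weighted_sq. apply Rplus_le_compat.
  - rewrite rsum_add. rewrite <- (Rplus_0_l (rsum n _)) at 1. apply Rplus_le_compat_r.
    apply rsum_ge0; intros; pose proof (pow2_ge_0 (Cmod (x i))); lra.
  - apply rsum_mono; [lia|]. intros i; pose proof (pow2_ge_0 (Cmod (y i))); lra.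
Qed.

(** * The Hilbert kernel *)

(** The moments of the Legendre polynomials on [0,1]: the number attached to m and a is the integral
    of t^a times the m-th Legendre polynomial, that is (a!)^2 / ((a-m)! (a+m+1)!).  It vanishes for
    a < m because of the factor a - k. *)
Fixpoint legendre (m : nat) (a : nat) : R :=
  match m with
  | O => / (INR a + 1)
  | S k => legendre k a * (INR a - INR k) / (INR a + INR k + 2)
  end.

Lemma legendre_0 m a : (a < m)%nat -> legendre m a = 0.
Proof.
  induction m as [|m IH]; intros H; [lia|]. simpl.
  destruct (Nat.eq_dec a m) as [->|]; [|rewrite IH by lia]; unfold Rdiv; ring.
Qed.

(** The expansion of 1/(1+a+b), the integral of t^a t^b, in Legendre polynomials; the remainder is
    explicit, so the sum telescopes. *)
Lemma legendre_partial m a b :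
  rsum m (fun k => (2 * INR k + 1) * (legendre k a * legendre k b)) =
  / (INR a + INR b + 1) - legendre m a * legendre m b *
     ((INR a + INR m + 1) * (INR b + INR m + 1)) / (INR a + INR b + 1).
Proof.
  pose proof (pos_INR a); pose proof (pos_INR b).
  induction m as [|m IH].
  - simpl. field. lra.
  - pose proof (pos_INR m). cbn [rsum]. rewrite IH. cbn [legendre]. rewrite S_INR. field.
    repeat split; lra.
Qed.

Lemma hilbert_kernel m a b : (a < m)%nat ->
  rsum m (fun k => (2 * INR k + 1) * (legendre k a * legendre k b)) = / (INR a + INR b + 1).
Proof. intros H. rewrite legendre_partial, legendre_0 by auto. unfold Rdiv. ring. Qed.

(** By [hilbert_kernel] the kernel is a nonnegative combination of rank one kernels u_i u_j.  For each
    of them entrywise multiplication multiplies the weight by u_i^2, and these squares add up to the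
    diagonal of the kernel. *)
Lemma dominated_hilbert r n X p : (forall i, 0 <= p i) -> dominated n X p ->
  dominated n (fun i j => (RtoC (/ (INR (i + r) + INR (j + r) + 1)) * X i j)%C)
    (fun i => / (INR (i + r) + INR (i + r) + 1) * p i).
Proof.
  intros Hp HX.
  apply dominated_weaken with
    (p := fun i => rsum (n + r) (fun k => (2 * INR k + 1) * (legendre k (i + r) ^ 2 * p i))).
  { intros i Hi. rewrite <- (hilbert_kernel (n + r)) by lia. apply Req_le.
    rewrite Rmult_comm, <- rsum_scal. apply rsum_ext; intros; ring. }
  apply dominated_ext with (X := fun i j => csum (n + r) (fun k =>
    (RtoC (2 * INR k + 1) * (RtoC (legendre k (i + r)) * X i j * RtoC (legendre k (j + r))))%C)).
  { intros i j Hi Hj. rewrite <- (hilbert_kernel (n + r)) by lia.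
    rewrite <- csum_RtoC, Cmult_comm, <- csum_scal. apply csum_ext; intros k _.
    rewrite !RtoC_mult. ring. }
  apply (dominated_csum n (n + r)
    (fun k i j => (RtoC (2 * INR k + 1) * (RtoC (legendre k (i + r)) * X i j * RtoC (legendre k (j + r))))%C)
    (fun k i => (2 * INR k + 1) * (legendre k (i + r) ^ 2 * p i))).
  intros k _. pose proof (pos_INR k).
  apply dominated_weaken with (p := fun i => Cmod (RtoC (2 * INR k + 1)) * (legendre k (i + r) ^ 2 * p i)).
  { intros i _. rewrite Cmod_R, Rabs_pos_eq by lra. lra. }
  apply dominated_scal.
  apply dominated_diag; auto; intros i; rewrite Cmod_R, pow2_abs; lra.
Qed.

(** * Nuclear matrices *)

Lemma dominated_pairing n X p M c :
  0 < p -> dominated n X (fun _ => p) ->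
  (forall n X, dominated n X (fun _ => 1) -> Cmod (pairing n X M) <= c) ->
  Cmod (pairing n X M) <= p * c.
Proof.
  intros Hp HX HM. 
  assert (H : dominated n (fun i j => (RtoC (/ p) * X i j)%C) (fun _ => 1)).
  { eapply dominated_weaken; [|apply dominated_scal, HX]. intros i _; cbv beta.
    rewrite Cmod_R, Rabs_pos_eq by (left; now apply Rinv_0_lt_compat).
    apply Req_le. field; lra. }
  apply HM in H. rewrite pairing_swap, pairing_scal, pairing_swap, Cmod_mult, Cmod_R, Rabs_pos_eq in H
    by (left; now apply Rinv_0_lt_compat).
  apply Rmult_le_reg_l with (/ p); [now apply Rinv_0_lt_compat|].
  rewrite <- Rmult_assoc, Rinv_l, Rmult_1_l by lra. exact H.
Qed.

Lemma nuclear_ext M M' : (forall i j, M i j = M' i j) -> nuclear M -> nuclear M'.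
Proof.
  intros E [c H]. exists c. intros n X HX. rewrite <- (pairing_ext n X X M M'); auto.
  intros; now rewrite E.
Qed.

Lemma nuclear_plus M M' : nuclear M -> nuclear M' -> nuclear (fun i j => (M i j + M' i j)%C).
Proof.
  intros [c H] [c' H']. exists (c + c'). intros n X HX. rewrite pairing_plus.
  eapply Rle_trans; [apply Cmod_triangle|]. apply Rplus_le_compat; auto.
Qed.

Lemma nuclear_scal a M : nuclear M -> nuclear (fun i j => (a * M i j)%C).
Proof.
  intros [c H]. exists (Cmod a * c). intros n X HX. rewrite pairing_scal, Cmod_mult.
  apply Rmult_le_compat_l; auto. apply Cmod_ge_0.
Qed.

(** * The Hilbert space of square summable sequences *)

Definition converges (u : nat -> C) (l : C) : Prop :=
  is_lim_seq (fun n => Re (u n)) (Re l) /\ is_lim_seq (fun n => Im (u n)) (Im l).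

Lemma C_eq (a b : C) : Re a = Re b -> Im a = Im b -> a = b.
Proof. intros; apply injective_projections; auto. Qed.

Lemma converges_unique u l l' : converges u l -> converges u l' -> l = l'.
Proof.
  intros [H1 H2] [H1' H2']. apply C_eq.
  - apply is_lim_seq_unique in H1, H1'. congruence.
  - apply is_lim_seq_unique in H2, H2'. congruence.
Qed.

Lemma converges_ext u v l : (forall n, u n = v n) -> converges u l -> converges v l.
Proof.
  intros E [H1 H2]. split.
  - eapply is_lim_seq_ext; [|exact H1]. intros; cbv beta; now rewrite E.
  - eapply is_lim_seq_ext; [|exact H2]. intros; cbv beta; now rewrite E.
Qed.

Lemma converges_const l : converges (fun _ => l) l.
Proof. split; apply is_lim_seq_const. Qed.

Lemma converges_eventually u l N : (forall n, (N <= n)%nat -> u n = l) -> converges u l.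
Proof.
  intros H. split.
  - apply (is_lim_seq_ext_loc (fun _ => Re l)); [|apply is_lim_seq_const].
    exists N. intros n Hn. now rewrite H.
  - apply (is_lim_seq_ext_loc (fun _ => Im l)); [|apply is_lim_seq_const].
    exists N. intros n Hn. now rewrite H.
Qed.

Lemma converges_plus u v l m : converges u l -> converges v m ->
  converges (fun n => (u n + v n)%C) (l + m)%C.
Proof. intros [H1 H2] [H1' H2']. split; simpl; now apply is_lim_seq_plus'. Qed.

Lemma converges_scal a u l : converges u l -> converges (fun n => (a * u n)%C) (a * l)%C.
Proof.
  intros [H1 H2]. split; simpl.
  - apply is_lim_seq_minus'; now apply (is_lim_seq_scal_l _ _ (Finite _)).
  - apply is_lim_seq_plus'; now apply (is_lim_seq_scal_l _ _ (Finite _)).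
Qed.

Lemma converges_conj u l : converges u l -> converges (fun n => Cconj (u n)) (Cconj l).
Proof. intros [H1 H2]. split; simpl; [exact H1 | now apply is_lim_seq_opp in H2]. Qed.

Lemma converges_Cmod2 u l : converges u l -> is_lim_seq (fun n => Cmod (u n) ^ 2) (Cmod l ^ 2).
Proof.
  intros [H1 H2]. rewrite Cmod2_alt.
  apply (is_lim_seq_ext (fun n => Re (u n) * Re (u n) + Im (u n) * Im (u n))).
  { intros n. rewrite Cmod2_alt. ring. }
  replace (Re l ^ 2 + Im l ^ 2) with (Re l * Re l + Im l * Im l) by ring.
  apply is_lim_seq_plus'; now apply is_lim_seq_mult'.
Qed.

Lemma rsum_lim m (f : nat -> nat -> R) (l : nat -> R) :
  (forall i, is_lim_seq (fun n => f n i) (l i)) ->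
  is_lim_seq (fun n => rsum m (f n)) (rsum m l).
Proof.
  intros H. induction m as [|m IH]; simpl; [apply is_lim_seq_const|].
  now apply is_lim_seq_plus'.
Qed.

Lemma csum_converges m (f : nat -> nat -> C) (l : nat -> C) :
  (forall i, (i < m)%nat -> converges (fun n => f n i) (l i)) ->
  converges (fun n => csum m (f n)) (csum m l).
Proof.
  intros H. induction m as [|m IH]; simpl; [apply converges_const|].
  apply converges_plus; auto.
Qed.

Lemma is_lim_seq_le_const (u : nat -> R) (l M : R) : is_lim_seq u l -> (forall n, u n <= M) -> l <= M.
Proof. intros H HM. exact (is_lim_seq_le _ _ _ _ HM H (is_lim_seq_const M)). Qed.

Lemma is_lim_seq_ge_const (u : nat -> R) (l M : R) : is_lim_seq u l -> (forall n, M <= u n) -> M <= l.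
Proof. intros H HM. exact (is_lim_seq_le _ _ _ _ HM (is_lim_seq_const M) H). Qed.

Lemma sum_n_rsum f n : sum_n f n = rsum (S n) f.
Proof.
  induction n as [|n IH].
  - rewrite sum_O. simpl. symmetry; apply Rplus_0_l.
  - rewrite sum_Sn, IH. reflexivity.
Qed.

Lemma is_series_rsum f l : is_series f l <-> is_lim_seq (fun n => rsum n f) l.
Proof.
  rewrite (is_lim_seq_incr_1 (fun n => rsum n f)). split; intros H.
  - eapply is_lim_seq_ext; [intros n; apply sum_n_rsum | exact H].
  - eapply is_lim_seq_ext in H; [exact H|]. intros n; symmetry; apply sum_n_rsum.
Qed.

Lemma rsum_le_Series f n : (forall i, 0 <= f i) -> ex_series f -> rsum n f <= Series f.
Proof.
  intros Hf Hex. pose proof (proj1 (is_series_rsum f (Series f)) (Series_correct _ Hex)) as H.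
  apply (is_lim_seq_incr_compare (fun n => rsum n f) _ H).
  intros k. simpl. specialize (Hf k). lra.
Qed.

Lemma bounded_ex_series f M : (forall i, 0 <= f i) -> (forall n, rsum n f <= M) ->
  ex_series f /\ Series f <= M.
Proof.
  intros Hf HM. destruct (ex_finite_lim_seq_incr (fun n => rsum n f) M) as [l Hl]; auto.
  { intros k. simpl. specialize (Hf k). lra. }
  assert (Hs : is_series f l) by now apply is_series_rsum.
  split; [now exists l|]. rewrite (is_series_unique _ _ Hs). now apply (is_lim_seq_le_const _ _ _ Hl).
Qed.

Lemma Cmod2_ge0 z : 0 <= Cmod z ^ 2.
Proof. apply pow2_ge_0. Qed.

Lemma ell2_bounded x M : (forall n, rsum n (fun i => Cmod (x i) ^ 2) <= M) -> ell2 x.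
Proof. intros H. eapply bounded_ex_series; [intros; apply Cmod2_ge0 | exact H]. Qed.

Lemma Cmod2_plus_le a b : Cmod (a + b)%C ^ 2 <= 2 * Cmod a ^ 2 + 2 * Cmod b ^ 2.
Proof. rewrite !Cmod2_alt. simpl. pose proof (pow2_ge_0 (fst a - fst b)). pose proof (pow2_ge_0 (snd a - snd b)). unfold Re, Im. simpl in *. lra. Qed.

Lemma ell2_plus x y : ell2 x -> ell2 y -> ell2 (fun k => (x k + y k)%C).
Proof.
  intros Hx Hy.
  apply (ell2_bounded _ (2 * Series (fun n => Cmod (x n) ^ 2) + 2 * Series (fun n => Cmod (y n) ^ 2))).
  intros n. eapply Rle_trans; [apply rsum_le; intros i _; apply Cmod2_plus_le|].
  rewrite rsum_plus, !rsum_scal.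
  pose proof (rsum_le_Series _ n (fun i => Cmod2_ge0 (x i)) Hx).
  pose proof (rsum_le_Series _ n (fun i => Cmod2_ge0 (y i)) Hy). lra.
Qed.

Lemma ell2_scal c x : ell2 x -> ell2 (fun k => (c * x k)%C).
Proof.
  intros Hx. apply (ell2_bounded _ (Cmod c ^ 2 * Series (fun n => Cmod (x n) ^ 2))).
  intros n. rewrite (rsum_ext n _ (fun i => Cmod c ^ 2 * Cmod (x i) ^ 2)).
  - rewrite rsum_scal. apply Rmult_le_compat_l; [apply Cmod2_ge0|].
    now apply rsum_le_Series; [intros; apply Cmod2_ge0|].
  - intros. now rewrite Cmod_mult, Rpow_mult_distr.
Qed.

Lemma ell2_finite n x : (forall i, (n <= i)%nat -> x i = RtoC 0) -> ell2 x.
Proof.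
  intros H. apply (ell2_bounded _ (rsum n (fun i => Cmod (x i) ^ 2))).
  intros m. destruct (Nat.le_ge_cases m n).
  - apply rsum_mono; auto. intros; apply Cmod2_ge0.
  - rewrite (rsum_widen n m); auto; [lra|]. intros i Hi. rewrite H by lia. rewrite Cmod_0. ring.
Qed.

(** Square summable sequences as a type of their own, so that operators are total maps and vector
    identities can be checked coordinatewise without membership conditions. *)
Definition L2 := { x : nat -> C | ell2 x }.

Definition coord (x : L2) : nat -> C := proj1_sig x.
Coercion coord : L2 >-> Funclass.

Lemma coord_ell2 (x : L2) : ell2 x.
Proof. exact (proj2_sig x). Qed.

Lemma L2_ext (x y : L2) : (forall n, x n = y n) -> x = y.
Proof.
  destruct x as [x hx], y as [y hy]. simpl. intros E.
  assert (x = y) as -> by (extensionality n; apply E). f_equal. apply proof_irrelevance.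
Qed.

Definition hadd (x y : L2) : L2 := exist _ _ (ell2_plus _ _ (coord_ell2 x) (coord_ell2 y)).
Definition hscal (c : C) (x : L2) : L2 := exist _ _ (ell2_scal c _ (coord_ell2 x)).
Definition hsub (x y : L2) : L2 := hadd x (hscal (RtoC (-1)) y).
Definition hzero : L2 := exist _ _ (ell2_finite 0 (fun _ => RtoC 0) (fun _ _ => eq_refl)).

Lemma basis_ell2 k : ell2 (basis k).
Proof.
  apply (ell2_finite (S k)). intros i Hi. unfold basis. now rewrite (proj2 (Nat.eqb_neq i k)) by lia.
Qed.

Definition unit_vec (k : nat) : L2 := exist _ _ (basis_ell2 k).

Fixpoint hsum (n : nat) (F : nat -> L2) : L2 :=
  match n with O => hzero | S k => hadd (hsum k F) (F k) end.

Lemma hsum_coord n F i : hsum n F i = csum n (fun k => F k i).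
Proof. induction n as [|n IH]; simpl; [reflexivity|]. now rewrite <- IH. Qed.

Lemma hsum_ext n F G : (forall i, (i < n)%nat -> F i = G i) -> hsum n F = hsum n G.
Proof. intros E. apply L2_ext; intros i. rewrite !hsum_coord. apply csum_ext; intros k Hk. now rewrite E. Qed.

Definition ip (x y : L2) : C := inner x y.
Definition nsq (x : L2) : R := Re (ip x x).
Definition nrm (x : L2) : R := sqrt (nsq x).

(** The series of x_k conj(y_k) converges absolutely since 2|ab| <= |a|^2 + |b|^2. *)
Lemma ip_converges (x y : L2) : converges (fun n => csum n (fun k => (x k * Cconj (y k))%C)) (ip x y).
Proof.
  assert (Hex : forall p : C -> R, (forall z, Rabs (p z) <= Cmod z) ->
    ex_series (fun n => p (x n * Cconj (y n))%C)).
  { intros p Hp. apply ex_series_Rabs.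
    apply bounded_ex_series with (Series (fun n => Cmod (x n) ^ 2) + Series (fun n => Cmod (y n) ^ 2)).
    - intros; apply Rabs_pos.
    - intros n. apply Rle_trans with (rsum n (fun i => Cmod (x i) ^ 2) + rsum n (fun i => Cmod (y i) ^ 2)).
      + rewrite <- rsum_plus. apply rsum_le; intros i _. eapply Rle_trans; [apply Hp|].
        rewrite Cmod_mult, Cmod_conj. pose proof (pow2_ge_0 (Cmod (x i) - Cmod (y i))).
        pose proof (Cmod2_ge0 (x i)); pose proof (Cmod2_ge0 (y i)). nra.
      + apply Rplus_le_compat; apply rsum_le_Series; try apply coord_ell2; intros; apply Cmod2_ge0. }
  split.
  - apply (is_lim_seq_ext (fun n => rsum n (fun k => Re (x k * Cconj (y k))%C))).
    + intros n; induction n as [|n IH]; [reflexivity|]. cbn [rsum csum]. rewrite IH. reflexivity.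
    + apply is_series_rsum, Series_correct, (Hex Re). apply re_le_Cmod.
  - apply (is_lim_seq_ext (fun n => rsum n (fun k => Im (x k * Cconj (y k))%C))).
    + intros n; induction n as [|n IH]; [reflexivity|]. cbn [rsum csum]. rewrite IH. reflexivity.
    + apply is_series_rsum, Series_correct, (Hex Im). intros z. eapply Rle_trans; [|apply Rmax_Cmod]. apply Rmax_r.
Qed.

Lemma ip_add_l x y z : ip (hadd x y) z = (ip x z + ip y z)%C.
Proof.
  eapply converges_unique; [apply ip_converges|].
  eapply converges_ext; [|apply converges_plus; apply ip_converges].
  intros n. cbv beta. rewrite <- csum_plus. apply csum_ext; intros; simpl; ring.
Qed.

Lemma ip_scal_l c x z : ip (hscal c x) z = (c * ip x z)%C.
Proof.
  eapply converges_unique; [apply ip_converges|].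
  eapply converges_ext; [|apply converges_scal; apply ip_converges].
  intros n. cbv beta. rewrite <- csum_scal. apply csum_ext; intros; simpl; ring.
Qed.

Lemma ip_conj x y : ip y x = Cconj (ip x y).
Proof.
  eapply converges_unique; [apply ip_converges|].
  eapply converges_ext; [|apply converges_conj; apply ip_converges].
  intros n. cbv beta. rewrite csum_conj. apply csum_ext; intros. rewrite Cmult_conj, Cconj_conj. ring.
Qed.

Lemma Re_self z : Re (z * Cconj z)%C = Cmod z ^ 2.
Proof. rewrite <- Cmod2_conj. reflexivity. Qed.

Lemma nsq_Series (x : L2) : nsq x = Series (fun n => Cmod (x n) ^ 2).
Proof. apply Series_ext. intros; apply Re_self. Qed.

Lemma nrm_ell2_norm (x : L2) : nrm x = ell2_norm x.
Proof. unfold nrm, ell2_norm. now rewrite nsq_Series. Qed.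

Lemma rsum_le_nsq (x : L2) n : rsum n (fun i => Cmod (x i) ^ 2) <= nsq x.
Proof. rewrite nsq_Series. apply rsum_le_Series; [intros; apply Cmod2_ge0 | apply coord_ell2]. Qed.

Lemma nsq_lim (x : L2) : is_lim_seq (fun n => rsum n (fun i => Cmod (x i) ^ 2)) (nsq x).
Proof. rewrite nsq_Series. apply is_series_rsum, Series_correct, coord_ell2. Qed.

Lemma nsq_le (x : L2) M : (forall n, rsum n (fun i => Cmod (x i) ^ 2) <= M) -> nsq x <= M.
Proof. intros HM. eapply is_lim_seq_le_const; [apply nsq_lim | exact HM]. Qed.

Lemma nsq_ge0 x : 0 <= nsq x.
Proof. apply (rsum_le_nsq x 0). Qed.

(** * Positive semidefinite forms *)

Record psd (Q : L2 -> L2 -> C) : Prop := {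
  psd_add : forall x y z, Q (hadd x y) z = (Q x z + Q y z)%C;
  psd_scal : forall c x z, Q (hscal c x) z = (c * Q x z)%C;
  psd_conj : forall x y, Q y x = Cconj (Q x y);
  psd_pos : forall x, 0 <= Re (Q x x)
}.

Section PositiveForm.

Context (Q : L2 -> L2 -> C) (HQ : psd Q).

Lemma form_add_r x y z : Q x (hadd y z) = (Q x y + Q x z)%C.
Proof. now rewrite (psd_conj _ HQ), (psd_add _ HQ), Cplus_conj, <- !(psd_conj _ HQ). Qed.

Lemma form_scal_r c x y : Q x (hscal c y) = (Cconj c * Q x y)%C.
Proof. now rewrite (psd_conj _ HQ), (psd_scal _ HQ), Cmult_conj, <- !(psd_conj _ HQ). Qed.

Lemma form_sub_l x y z : Q (hsub x y) z = (Q x z - Q y z)%C.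
Proof. unfold hsub. rewrite (psd_add _ HQ), (psd_scal _ HQ). ring. Qed.

Lemma Cconj_R (r : R) : Cconj (RtoC r) = RtoC r.
Proof. apply C_eq; simpl; ring. Qed.

Lemma form_sub_r x y z : Q x (hsub y z) = (Q x y - Q x z)%C.
Proof. unfold hsub. rewrite form_add_r, form_scal_r, Cconj_R. ring. Qed.

Lemma form_zero_l z : Q hzero z = RtoC 0.
Proof.
  replace hzero with (hscal 0 hzero) by (apply L2_ext; intros; simpl; ring).
  rewrite (psd_scal _ HQ). ring.
Qed.

Lemma form_sum_l n F z : Q (hsum n F) z = csum n (fun k => Q (F k) z).
Proof.
  induction n as [|n IH]; simpl; [apply form_zero_l|]. now rewrite (psd_add _ HQ), IH.
Qed.

Lemma form_sum_r n F z : Q z (hsum n F) = csum n (fun k => Q z (F k)).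
Proof.
  rewrite (psd_conj _ HQ), form_sum_l, csum_conj. apply csum_ext; intros. now rewrite <- (psd_conj _ HQ).
Qed.

Lemma form_self x : Q x x = RtoC (Re (Q x x)).
Proof.
  apply C_eq; [reflexivity|]. change (Im (Q x x) = 0).
  pose proof (f_equal Im (psd_conj _ HQ x x)) as E. rewrite im_conj in E. lra.
Qed.

(** The form is nonnegative at x - t Q(x,y) y for every real t. *)
Lemma form_cauchy_schwarz x y : Cmod (Q x y) ^ 2 <= Re (Q x x) * Re (Q y y).
Proof.
  set (m := Cmod (Q x y) ^ 2).
  (* The choice t = 1/Q(y,y) gives the inequality; when Q(y,y) = 0 the polynomial in t is affine and a
     large t forces m = 0. *)
  assert (K : forall t : R, 0 <= Re (Q x x) - 2 * t * m + t ^ 2 * m * Re (Q y y)).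
  { intros t. pose proof (psd_pos _ HQ (hsub x (hscal (RtoC t * Q x y)%C y))) as P.
    rewrite form_sub_l, !form_sub_r, !(psd_scal _ HQ), !form_scal_r, (psd_conj _ HQ x y), (form_self y) in P.
    rewrite !Cmult_conj, !Cconj_R in P.
    match type of P with 0 <= ?e => replace e with (Re (Q x x) - 2 * t * m + t ^ 2 * m * Re (Q y y)) in P end; auto.
    unfold m. rewrite Cmod2_alt. unfold Re, Im. simpl. ring. }
  pose proof (psd_pos _ HQ y) as Py. pose proof (psd_pos _ HQ x) as Px.
  assert (Hm : 0 <= m) by apply Cmod2_ge0.
  destruct (Rle_lt_or_eq_dec _ _ Py) as [Hb | Hb].
  - specialize (K (/ Re (Q y y))).
    replace (Re (Q x x) - 2 * / Re (Q y y) * m + (/ Re (Q y y)) ^ 2 * m * Re (Q y y)) with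
      ((Re (Q x x) * Re (Q y y) - m) / Re (Q y y)) in K by (field; lra).
    apply (Rmult_le_compat_r (Re (Q y y))) in K; [|lra].
    unfold Rdiv in K. rewrite Rmult_assoc, Rinv_l in K by lra. lra.
  - rewrite <- Hb in *. rewrite Rmult_0_r. destruct (Rle_lt_or_eq_dec _ _ Hm) as [Hm' | Hm']; [|lra].
    specialize (K ((Re (Q x x) + 1) / (2 * m))).
    replace (2 * ((Re (Q x x) + 1) / (2 * m)) * m) with (Re (Q x x) + 1) in K by (field; lra). lra.
Qed.

Lemma form_null x y : Re (Q x x) = 0 -> Q x y = RtoC 0.
Proof.
  intros E. pose proof (form_cauchy_schwarz x y) as P. rewrite E, Rmult_0_l in P.
  apply Cmod_eq_0. pose proof (Cmod_ge_0 (Q x y)). nra.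
Qed.

Lemma form_null_r x y : Re (Q y y) = 0 -> Q x y = RtoC 0.
Proof. intros E. rewrite (psd_conj _ HQ), form_null by auto. apply C_eq; simpl; ring. Qed.

End PositiveForm.

Lemma ip_psd : psd ip.
Proof.
  split; [apply ip_add_l | apply ip_scal_l | apply ip_conj | apply nsq_ge0].
Qed.

Lemma nrm_ge0 x : 0 <= nrm x.
Proof. apply sqrt_pos. Qed.

Lemma nrm_sq x : nrm x ^ 2 = nsq x.
Proof. apply pow2_sqrt, nsq_ge0. Qed.

Lemma nrm_le x r : 0 <= r -> nsq x <= r ^ 2 -> nrm x <= r.
Proof. intros Hr Hx. unfold nrm. rewrite <- (sqrt_pow2 r) by auto. now apply sqrt_le_1_alt. Qed.

Lemma cauchy_schwarz x y : Cmod (ip x y) <= nrm x * nrm y.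
Proof.
  apply Rsqr_incr_0_var; [|apply Rmult_le_pos; apply nrm_ge0].
  rewrite !Rsqr_pow2, Rpow_mult_distr, !nrm_sq. apply (form_cauchy_schwarz _ ip_psd).
Qed.

Lemma nsq_add x y : nsq (hadd x y) = nsq x + 2 * Re (ip x y) + nsq y.
Proof.
  unfold nsq. rewrite ip_add_l, !(form_add_r _ ip_psd), (ip_conj x y). simpl. lra.
Qed.

Lemma nrm_triangle x y : nrm (hadd x y) <= nrm x + nrm y.
Proof.
  pose proof (nrm_ge0 x); pose proof (nrm_ge0 y).
  apply nrm_le; [lra|]. rewrite nsq_add, <- !nrm_sq.
  pose proof (cauchy_schwarz x y). pose proof (re_le_Cmod (ip x y)). pose proof (Rle_abs (Re (ip x y))). nra.
Qed.

Lemma nsq_scal c x : nsq (hscal c x) = Cmod c ^ 2 * nsq x.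
Proof.
  unfold nsq. rewrite ip_scal_l, (form_scal_r _ ip_psd), (form_self _ ip_psd), Cmult_assoc, <- Cmod2_conj.
  rewrite <- RtoC_mult. reflexivity.
Qed.

Lemma nrm_scal c x : nrm (hscal c x) = Cmod c * nrm x.
Proof.
  unfold nrm. rewrite nsq_scal, sqrt_mult, sqrt_pow2; auto using Cmod_ge_0, Cmod2_ge0, nsq_ge0.
Qed.

Lemma nrm_sub_sym x y : nrm (hsub x y) = nrm (hsub y x).
Proof.
  replace (hsub x y) with (hscal (RtoC (-1)) (hsub y x)) by (apply L2_ext; intros; simpl; ring).
  rewrite nrm_scal, Cmod_R, Rabs_left by lra. ring.
Qed.

Lemma nrm_sub_triangle x y z : nrm (hsub x z) <= nrm (hsub x y) + nrm (hsub y z).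
Proof.
  replace (hsub x z) with (hadd (hsub x y) (hsub y z)) by (apply L2_ext; intros; simpl; ring).
  apply nrm_triangle.
Qed.

Lemma nsq_0 x : nsq x = 0 -> x = hzero.
Proof.
  intros E. apply L2_ext; intros n. change (x n = RtoC 0). apply Cmod_eq_0.
  pose proof (rsum_le_nsq x (S n)) as P. cbn [rsum] in P.
  pose proof (rsum_ge0 n (fun i => Cmod (x i) ^ 2) (fun i _ => Cmod2_ge0 _)).
  pose proof (Cmod_ge_0 (x n)). rewrite E in P. cbv beta in *. nra.
Qed.

Lemma nrm_sub_0 x y : nrm (hsub x y) <= 0 -> x = y.
Proof.
  intros E. pose proof (nrm_ge0 (hsub x y)). pose proof (nrm_sq (hsub x y)) as S.
  assert (nsq (hsub x y) = 0) as Z by nra. apply nsq_0 in Z.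
  apply L2_ext; intros n. apply (f_equal (fun z : L2 => z n)) in Z. simpl in Z.
  replace (x n) with (x n + RtoC (-1) * y n + y n)%C by ring. rewrite Z. ring.
Qed.

Lemma coord_le_nrm (x : L2) i : Cmod (x i) <= nrm x.
Proof.
  apply Rsqr_incr_0_var; [|apply nrm_ge0]. rewrite !Rsqr_pow2, nrm_sq.
  pose proof (rsum_le_nsq x (S i)) as P. cbn [rsum] in P.
  pose proof (rsum_ge0 i (fun k => Cmod (x k) ^ 2) (fun k _ => Cmod2_ge0 _)). lra.
Qed.

Lemma ip_unit (x : L2) i : ip x (unit_vec i) = x i.
Proof.
  eapply converges_unique; [apply ip_converges|].
  apply (converges_eventually _ _ (S i)). intros n Hn.
  rewrite (csum_single n i) by (try lia; intros j _ Hj; simpl; unfold basis;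
    rewrite (proj2 (Nat.eqb_neq j i)) by auto; rewrite Cconj_R; ring).
  simpl. unfold basis. rewrite Nat.eqb_refl, Cconj_R. ring.
Qed.

Definition trunc (n : nat) (x : L2) : L2 := hsum n (fun i => hscal (x i) (unit_vec i)).

Lemma trunc_coord n (x : L2) i : trunc n x i = if Nat.ltb i n then x i else RtoC 0.
Proof.
  unfold trunc. rewrite hsum_coord. destruct (Nat.ltb_spec i n).
  - rewrite (csum_single n i); auto.
    + simpl. unfold basis. rewrite Nat.eqb_refl. ring.
    + intros j _ Hj. simpl. unfold basis. rewrite (proj2 (Nat.eqb_neq i j)) by auto. ring.
  - apply csum_0. intros j Hj. simpl. unfold basis. rewrite (proj2 (Nat.eqb_neq i j)) by lia. ring.
Qed.

Lemma trunc_tail n (x : L2) :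
  nsq (hsub x (trunc n x)) <= nsq x - rsum n (fun i => Cmod (x i) ^ 2).
Proof.
  apply nsq_le. intros N. apply Rle_trans with (rsum (N + n) (fun i => Cmod (hsub x (trunc n x) i) ^ 2)).
  { apply rsum_mono; [lia | intros; apply Cmod2_ge0]. }
  pose proof (rsum_le_nsq x (N + n)) as P. rewrite rsum_add in P |- *.
  rewrite rsum_0.
  - rewrite (rsum_ext N _ (fun i => Cmod (x (i + n)%nat) ^ 2)); [lra|].
    intros i _. simpl. rewrite trunc_coord, (proj2 (Nat.ltb_ge _ _)) by lia.
    replace (x (i + n)%nat + RtoC (-1) * RtoC 0)%C with (x (i + n)%nat) by ring. reflexivity.
  - intros i Hi. simpl. rewrite trunc_coord, (proj2 (Nat.ltb_lt _ _)) by lia.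
    replace (x i + RtoC (-1) * x i)%C with (RtoC 0) by ring. rewrite Cmod_0. ring.
Qed.

(** Finitely supported vectors are dense. *)
Lemma trunc_lim (x : L2) : is_lim_seq (fun n => nrm (hsub x (trunc n x))) 0.
Proof.
  apply (is_lim_seq_le_le (fun _ => 0) _ (fun n => sqrt (nsq x - rsum n (fun i => Cmod (x i) ^ 2)))).
  - intros n. split; [apply nrm_ge0 | apply sqrt_le_1_alt, trunc_tail].
  - apply is_lim_seq_const.
  - rewrite <- sqrt_0. apply is_lim_seq_continuous; [apply continuity_pt_sqrt; lra|].
    replace 0 with (nsq x - nsq x) by ring. apply is_lim_seq_minus'; [apply is_lim_seq_const | apply nsq_lim].
Qed.

(** Stated with an explicit rate r, so that the limits met later come with error bounds. *)
Lemma L2_complete (X : nat -> L2) (r : nat -> R) :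
  is_lim_seq r 0 -> (forall n m, (n <= m)%nat -> nrm (hsub (X m) (X n)) <= r n) ->
  exists x, forall n, nrm (hsub (X n) x) <= r n.
Proof.
  intros Hr HX.
  assert (Hr0 : forall n, 0 <= r n) by (intros n; eapply Rle_trans; [apply nrm_ge0 | apply (HX n n)]; lia).
  assert (Hc : forall (p : C -> R) i, (forall a b, p (a - b)%C = p a - p b) -> (forall a, Rabs (p a) <= Cmod a) ->
     is_lim_seq (fun n => p (X n i)) (real (Lim_seq (fun n => p (X n i))))).
  { intros p i Hp Hle. apply Lim_seq_correct', ex_lim_seq_cauchy_corr. intros eps.
    assert (He : 0 < eps / 2) by (destruct eps; simpl; lra).
    destruct (proj2 (is_lim_seq_spec r 0) Hr (mkposreal _ He)) as [N HN]. simpl in HN.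
    exists N. 
    assert (D : forall n, (N <= n)%nat -> Rabs (p (X n i) - p (X N i)) < eps / 2).
    { intros n Hn. rewrite <- Hp. eapply Rle_lt_trans; [apply Hle|].
      replace (X n i - X N i)%C with (hsub (X n) (X N) i) by (simpl; ring).
      eapply Rle_lt_trans; [apply coord_le_nrm|]. eapply Rle_lt_trans; [apply HX; auto|].
      specialize (HN N (Nat.le_refl N)). rewrite Rminus_0_r in HN. now apply Rabs_def2 in HN. }
    intros n m Hn Hm. pose proof (D n Hn) as D1. pose proof (D m Hm) as D2.
    apply Rabs_def2 in D1, D2. apply Rabs_def1; lra. }
  set (z := fun i => (real (Lim_seq (fun n => Re (X n i))), real (Lim_seq (fun n => Im (X n i)))) : C).
  assert (Hz : forall i, converges (fun n => X n i) (z i)).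
  { intros i. split; simpl.
    - apply (Hc Re); [reflexivity | apply re_le_Cmod].
    - apply (Hc Im); [reflexivity |]. intros a. eapply Rle_trans; [|apply Rmax_Cmod]. apply Rmax_r. }
  assert (Hd : forall n N, rsum N (fun i => Cmod (X n i + RtoC (-1) * z i)%C ^ 2) <= r n ^ 2).
  { intros n N. 
    assert (L : is_lim_seq (fun m => rsum N (fun i => Cmod (X n i + RtoC (-1) * X (m + n)%nat i)%C ^ 2))
       (rsum N (fun i => Cmod (X n i + RtoC (-1) * z i)%C ^ 2))).
    { apply rsum_lim. intros i. 
      apply (is_lim_seq_incr_n (fun m => Cmod (X n i + RtoC (-1) * X m i)%C ^ 2) n).
      apply converges_Cmod2. apply converges_plus; [apply converges_const | apply converges_scal, Hz]. }
    apply (is_lim_seq_le_const _ _ _ L). intros m. 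
    eapply Rle_trans; [apply (rsum_le_nsq (hsub (X n) (X (m + n)%nat)) N)|].
    rewrite <- nrm_sq. apply pow_incr. split; [apply nrm_ge0|]. rewrite nrm_sub_sym. apply HX. lia. }
  assert (Ez : ell2 z).
  { replace z with (fun i => (X 0%nat i + RtoC (-1) * (X 0%nat i + RtoC (-1) * z i))%C)
      by (extensionality i; ring).
    apply ell2_plus; [apply coord_ell2 | apply ell2_scal]. exact (ell2_bounded _ _ (Hd 0%nat)). }
  exists (exist _ z Ez). intros n. apply nrm_le; auto. apply nsq_le. apply Hd.
Qed.

(** * Gram-Schmidt orthogonalization *)

(** A null vector is scaled by 0, any other one by the inverse of its length. *)
Lemma form_normalization Q (HQ : psd Q) r : exists c : C,
  let g := hscal c r in
  (Re (Q g g) = 0 \/ Re (Q g g) = 1) /\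
  Re (Q (hsub r (hscal (Q r g) g)) (hsub r (hscal (Q r g) g))) = 0.
Proof.
  pose proof (psd_pos _ HQ r) as Hr. destruct (Rle_lt_or_eq_dec _ _ Hr) as [Ha|Ha].
  - set (a := Re (Q r r)) in *. exists (RtoC (/ sqrt a)).
    assert (Hs : sqrt a * sqrt a = a) by (apply sqrt_sqrt; lra).
    assert (Hp : 0 < sqrt a) by now apply sqrt_lt_R0.
    cbv zeta. split.
    + right. rewrite (psd_scal _ HQ), (form_scal_r _ HQ), (form_self _ HQ r), Cconj_R, <- !RtoC_mult.
      simpl. fold a. rewrite <- Hs at 3. field. lra.
    + replace (hsub r _) with hzero.
      { now rewrite (form_zero_l _ HQ). }
      apply L2_ext; intros n. simpl. rewrite (form_scal_r _ HQ), (form_self _ HQ r), Cconj_R. fold a.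
      rewrite !Cmult_assoc, <- !RtoC_mult.
      replace (-1 * / sqrt a * a * / sqrt a) with (-1); [ring|].
      rewrite <- Hs at 2. field. lra.
  - exists (RtoC 0). cbv zeta. split.
    + left. rewrite (psd_scal _ HQ), Cmult_0_l. reflexivity.
    + replace (hsub r _) with r; [congruence|]. apply L2_ext; intros n; simpl. ring.
Qed.

Definition expansion Q (f : nat -> L2) (n : nat) (x : L2) : L2 :=
  hsum n (fun k => hscal (Q x (f k)) (f k)).

(** Since the form may be degenerate, the f_k have length 1 or 0, and the e_j are only recovered up
    to vectors of length 0.  These are harmless: they are annihilated by the operators that define
    the forms to which this is applied. *)
Lemma gram_schmidt Q (HQ : psd Q) (e : nat -> L2) n : exists f : nat -> L2,
  (forall k l, (k < n)%nat -> (l < n)%nat -> k <> l -> Q (f k) (f l) = RtoC 0) /\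
  (forall k, (k < n)%nat -> Re (Q (f k) (f k)) = 0 \/ Re (Q (f k) (f k)) = 1) /\
  (forall j, (j < n)%nat ->
     Re (Q (hsub (e j) (expansion Q f n (e j))) (hsub (e j) (expansion Q f n (e j)))) = 0).
Proof.
  induction n as [|n [f [Ho [Hn He]]]].
  { exists (fun _ => hzero). repeat split; intros; lia. }
  set (r := hsub (e n) (expansion Q f n (e n))).
  assert (Hrf : forall l, (l < n)%nat -> Q r (f l) = RtoC 0).
  { intros l Hl. unfold r, expansion. rewrite (form_sub_l _ HQ), (form_sum_l _ HQ), (csum_single n l); auto.
    - rewrite (psd_scal _ HQ). destruct (Hn l Hl) as [E|E].
      + rewrite (form_null_r _ HQ (e n) (f l)) by auto. ring.
      + rewrite (form_self _ HQ (f l)), E. ring.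
    - intros k Hk Hkl. rewrite (psd_scal _ HQ), Ho by auto. ring. }
  destruct (form_normalization Q HQ r) as [c [Hg Hw]]. set (g := hscal c r) in *. cbv zeta in Hg, Hw.
  assert (Hgf : forall l, (l < n)%nat -> Q g (f l) = RtoC 0)
    by (intros l Hl; unfold g; rewrite (psd_scal _ HQ), Hrf by auto; ring).
  assert (Hfg : forall l, (l < n)%nat -> Q (f l) g = RtoC 0)
    by (intros l Hl; rewrite (psd_conj _ HQ), Hgf, Cconj_R by auto; reflexivity).
  set (f' := fun k => if Nat.ltb k n then f k else g).
  assert (Ef : forall k, (k < n)%nat -> f' k = f k)
    by (intros k Hk; unfold f'; now rewrite (proj2 (Nat.ltb_lt _ _)) by lia).
  assert (Eg : f' n = g) by (unfold f'; now rewrite Nat.ltb_irrefl).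
  assert (Ex : forall x, expansion Q f' (S n) x = hadd (expansion Q f n x) (hscal (Q x g) g)).
  { intros x. unfold expansion. simpl. rewrite Eg. f_equal. apply hsum_ext. intros k Hk. now rewrite Ef. }
  (* The new vector is orthogonal to the previous ones, so it only sees the residual of x. *)
  assert (Eq : forall x, Q x g = Q (hsub x (expansion Q f n x)) g).
  { intros x. rewrite (form_sub_l _ HQ). unfold expansion. rewrite (form_sum_l _ HQ), csum_0; [ring|].
    intros k Hk. rewrite (psd_scal _ HQ), Hfg by auto. ring. }
  exists f'. split; [|split].
  - intros k l Hk Hl Hkl. destruct (Nat.eq_dec k n) as [->|], (Nat.eq_dec l n) as [->|]; try lia;
      rewrite ?Eg, ?Ef by lia; [apply Hgf | apply Hfg | apply Ho]; lia.
  - intros k Hk. destruct (Nat.eq_dec k n) as [->|]; [now rewrite Eg | rewrite Ef by lia; apply Hn; lia].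
  - intros j Hj. rewrite Ex, Eq. destruct (Nat.eq_dec j n) as [->|].
    + fold r. replace (hsub (e n) (hadd (expansion Q f n (e n)) (hscal (Q r g) g)))
        with (hsub r (hscal (Q r g) g)); [exact Hw|].
      apply L2_ext; intros i; unfold r; simpl. ring.
    + rewrite (form_null _ HQ (hsub (e j) (expansion Q f n (e j)))) by (apply He; lia).
      replace (hsub (e j) (hadd _ _)) with (hsub (e j) (expansion Q f n (e j))); [apply He; lia|].
      apply L2_ext; intros i; simpl. ring.
Qed.

(** The form is nonnegative at x minus its expansion. *)
Lemma form_bessel Q (HQ : psd Q) (f : nat -> L2) n x :
  (forall k l, (k < n)%nat -> (l < n)%nat -> k <> l -> Q (f k) (f l) = RtoC 0) ->
  (forall k, (k < n)%nat -> Re (Q (f k) (f k)) = 0 \/ Re (Q (f k) (f k)) = 1) ->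
  rsum n (fun k => Cmod (Q x (f k)) ^ 2) <= Re (Q x x).
Proof.
  intros Ho Hn. pose proof (psd_pos _ HQ (hsub x (expansion Q f n x))) as P.
  set (b := rsum n (fun k => Cmod (Q x (f k)) ^ 2)).
  assert (E1 : Q (expansion Q f n x) x = RtoC b).
  { unfold expansion. rewrite (form_sum_l _ HQ). unfold b. rewrite <- csum_RtoC.
    apply csum_ext; intros k _. rewrite (psd_scal _ HQ), (psd_conj _ HQ x (f k)). symmetry. apply Cmod2_conj. }
  assert (E2 : Q x (expansion Q f n x) = RtoC b) by (now rewrite (psd_conj _ HQ), E1, Cconj_R).
  assert (E3 : Q (expansion Q f n x) (expansion Q f n x) = RtoC b).
  { unfold expansion at 2. rewrite (form_sum_r _ HQ). unfold b. rewrite <- csum_RtoC.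
    apply csum_ext; intros k Hk. rewrite (form_scal_r _ HQ). unfold expansion.
    rewrite (form_sum_l _ HQ), (csum_single n k); auto.
    - rewrite (psd_scal _ HQ). destruct (Hn k Hk) as [E|E].
      + rewrite (form_null_r _ HQ x (f k)), Cmod_0 by auto. replace (0 ^ 2) with 0 by ring. ring.
      + rewrite (form_self _ HQ (f k)), E, Cmod2_conj. ring.
    - intros l Hl Hlk. rewrite (psd_scal _ HQ), Ho by auto. ring. }
  rewrite (form_sub_l _ HQ), !(form_sub_r _ HQ), E1, E2, E3, (form_self _ HQ x), <- !RtoC_minus in P.
  simpl in P. lra.
Qed.

(** * Trace class operators have nuclear matrices *)

Record linear (A : L2 -> L2) : Prop := {
  linear_add : forall x y, A (hadd x y) = hadd (A x) (A y);
  linear_scal : forall c x, A (hscal c x) = hscal c (A x)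
}.

Lemma linear_sub A x y : linear A -> A (hsub x y) = hsub (A x) (A y).
Proof. intros HA. unfold hsub. now rewrite (linear_add _ HA), (linear_scal _ HA). Qed.

Lemma linear_zero A : linear A -> A hzero = hzero.
Proof.
  intros HA. replace hzero with (hscal 0 hzero) at 1 by (apply L2_ext; intros; simpl; ring).
  rewrite (linear_scal _ HA). apply L2_ext; intros; simpl; ring.
Qed.

Lemma linear_sum A n F : linear A -> A (hsum n F) = hsum n (fun k => A (F k)).
Proof.
  intros HA. induction n as [|n IH]; simpl; [now apply linear_zero|]. now rewrite (linear_add _ HA), IH.
Qed.

(** Symmetry follows from the reality of <Px,x> by polarization, applied to x + y and i x + y. *)
Lemma positive_form P : linear P ->
  (forall x, Im (ip (P x) x) = 0 /\ 0 <= Re (ip (P x) x)) -> psd (fun x y => ip (P x) y).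
Proof.
  intros HP Hpos. split.
  - intros x y z. now rewrite (linear_add _ HP), ip_add_l.
  - intros c x z. now rewrite (linear_scal _ HP), ip_scal_l.
  - intros x y. pose proof (proj1 (Hpos (hadd x y))) as E1.
    pose proof (proj1 (Hpos (hadd (hscal Ci x) y))) as E2.
    pose proof (proj1 (Hpos x)) as Ex. pose proof (proj1 (Hpos y)) as Ey.
    rewrite !(linear_add _ HP), !ip_add_l, !(form_add_r _ ip_psd) in E1, E2.
    rewrite !(linear_scal _ HP), !ip_scal_l, !(form_scal_r _ ip_psd) in E2.
    unfold Re, Im in *. simpl in *. apply C_eq; unfold Re, Im; simpl; lra.
  - intros x. apply Hpos.
Qed.

(** Gram-Schmidt for Q(x,y) = <Px,y> gives e_j = sum_k Q(e_j,f_k) f_k up to a vector w with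
    Q(w,w) = 0; then Pw = 0, hence Tw = 0.  So the matrix of T is a sum over k of the rank one
    matrices with entries (T f_k)_i Q(e_j,f_k), where Q(e_j,f_k) is the conjugate of (P f_k)_j.  Both
    factors have norm |P f_k|, and sum_k |P f_k|^2 = sum_j sum_k |Q(e_j,f_k)|^2 is at most
    sum_j Q(e_j,e_j) by Bessel. *)
Lemma absolute_value_nuclear (T P : L2 -> L2) t :
  linear T -> linear P ->
  (forall x, Im (ip (P x) x) = 0 /\ 0 <= Re (ip (P x) x)) ->
  (forall x, nsq (T x) = nsq (P x)) ->
  (forall n, rsum n (fun k => Re (ip (P (unit_vec k)) (unit_vec k))) <= t) ->
  nuclear (fun i j => T (unit_vec j) i).
Proof.
  intros HT HP Hpos Hiso Htr. pose proof (positive_form P HP Hpos) as HQ.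
  set (Q := fun x y => ip (P x) y) in *.
  assert (Hnull : forall w, Re (Q w w) = 0 -> T w = hzero).
  { intros w Hw. apply nsq_0. rewrite Hiso. unfold nsq. 
    change (ip (P w) (P w)) with (Q w (P w)). rewrite (form_null _ HQ); auto. }
  exists t. intros n X HX.
  destruct (gram_schmidt Q HQ unit_vec n) as [f [Ho [Hn He]]].
  rewrite (pairing_ext n X X _ (fun i j => csum n (fun k => (T (f k) i * Q (unit_vec j) (f k))%C))).
  2:{ intros i j _ Hj. f_equal. specialize (Hnull _ (He j Hj)).
      rewrite (linear_sub _ _ _ HT) in Hnull. unfold expansion in Hnull. rewrite (linear_sum _ _ _ HT) in Hnull.
      apply (f_equal (fun z : L2 => z i)) in Hnull. simpl in Hnull. rewrite hsum_coord in Hnull.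
      replace (T (unit_vec j) i) with (T (unit_vec j) i + RtoC (-1) * csum n (fun k => T (hscal (Q (unit_vec j) (f k)) (f k)) i)
         + csum n (fun k => T (hscal (Q (unit_vec j) (f k)) (f k)) i))%C by ring.
      rewrite Hnull, Cplus_0_l. apply csum_ext; intros k _. rewrite (linear_scal _ HT). simpl. ring. }
  rewrite (pairing_csum n X n (fun k i j => (T (f k) i * Q (unit_vec j) (f k))%C)).
  eapply Rle_trans; [apply Cmod_csum|].
  assert (HP2 : rsum n (fun k => nsq (P (f k))) <= t).
  { apply (is_lim_seq_le_const (fun J => rsum n (fun k => rsum J (fun j => Cmod (P (f k) j) ^ 2)))).
    - apply (rsum_lim n (fun J k => rsum J (fun j => Cmod (P (f k) j) ^ 2))). intros k. apply nsq_lim.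
    - intros J. rewrite rsum_swap. eapply Rle_trans; [|apply (Htr J)]. apply rsum_le; intros j _.
      eapply Rle_trans; [|apply (form_bessel Q HQ f n (unit_vec j) Ho Hn)].
      apply rsum_le; intros k _. rewrite (psd_conj _ HQ), Cmod_conj. unfold Q. rewrite ip_unit. lra. }
  eapply Rle_trans; [|exact HP2]. apply rsum_le; intros k _.
  specialize (HX (fun i => T (f k) i) (fun j => Q (unit_vec j) (f k))).
  cbv beta in HX |- *.
  assert (S1 : weighted_sq n (fun _ => 1) (fun i => T (f k) i) <= nsq (P (f k))).
  { rewrite <- Hiso. eapply Rle_trans; [|apply (rsum_le_nsq (T (f k)) n)]. apply rsum_le; intros; lra. }
  assert (S2 : weighted_sq n (fun _ => 1) (fun j => Q (unit_vec j) (f k)) <= nsq (P (f k))).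
  { eapply Rle_trans; [|apply (rsum_le_nsq (P (f k)) n)]. apply rsum_le; intros j _.
    rewrite (psd_conj _ HQ), Cmod_conj. unfold Q. rewrite ip_unit. lra. }
  lra.
Qed.

Definition operator (T : (nat -> C) -> nat -> C) (HT : forall x, ell2 x -> ell2 (T x)) (x : L2) : L2 :=
  exist _ (T x) (HT x (coord_ell2 x)).

Lemma operator_linear T (HT : bounded_operator T) : linear (operator T (bounded_operator_ell2 _ HT)).
Proof.
  split.
  - intros x y. apply L2_ext; intros n. apply (bounded_operator_add _ HT); apply coord_ell2.
  - intros c x. apply L2_ext; intros n. apply (bounded_operator_scal _ HT); apply coord_ell2.
Qed.

Lemma matrix_in_S1_nuclear M : matrix_in_S1 M -> nuclear M.
Proof.
  intros [T [[HT [P [[[HP Hpos] [S [[HS Hadj] Hsq]]] Htr]]] HM]].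
  set (T' := operator T (bounded_operator_ell2 _ HT)).
  set (P' := operator P (bounded_operator_ell2 _ HP)).
  set (S' := operator S (bounded_operator_ell2 _ HS)).
  apply (nuclear_ext (fun i j => T' (unit_vec j) i)).
  { intros i j. rewrite <- HM, <- ip_unit. reflexivity. }
  pose proof (operator_linear _ HP) as LP. fold P' in LP.
  assert (Hpos' : forall x : L2, Im (ip (P' x) x) = 0 /\ 0 <= Re (ip (P' x) x))
    by (intros x; apply Hpos, coord_ell2).
  pose proof (positive_form P' LP Hpos') as HQ.
  apply absolute_value_nuclear with (P := P') (t := Series (fun n => Re (inner (P (basis n)) (basis n)))).
  - apply operator_linear.
  - exact LP.
  - exact Hpos'.
  - intros x. unfold nsq. f_equal.
    transitivity (ip x (S' (T' x))); [apply Hadj; apply coord_ell2|].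
    replace (S' (T' x)) with (P' (P' x)) by (apply L2_ext; intros n; apply (Hsq x (coord_ell2 x))).
    rewrite ip_conj. symmetry. exact (psd_conj _ HQ (P' x) x).
  - intros n. eapply Rle_trans; [|apply (rsum_le_Series _ n); [|exact Htr]].
    + apply rsum_le; intros k _. apply Rle_refl.
    + intros k. apply (proj2 (Hpos (basis k) (basis_ell2 k))).
Qed.

(** * Absolute values of operators *)

Definition selfadjoint (A : L2 -> L2) : Prop := forall x y, ip (A x) y = ip x (A y).

(** Successive approximations of the solution Y of 2Y = A + Y^2; then 1 - Y is a square root of
    1 - A. *)
Fixpoint root_iter (A : L2 -> L2) (n : nat) (x : L2) : L2 :=
  match n with
  | O => hzero
  | S k => hscal (RtoC (/ 2)) (hadd (A x) (root_iter A k (root_iter A k x)))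
  end.

(** The same iteration for A = 1.  It majorizes the norms of the approximations and of their
    successive differences, which makes convergence immediate. *)
Fixpoint root_bound (n : nat) : R :=
  match n with O => 0 | S k => / 2 * (1 + root_bound k ^ 2) end.

Lemma root_bound_range n : 0 <= root_bound n <= 1.
Proof. induction n as [|n IH]; simpl; [lra|]. nra. Qed.

Lemma root_bound_incr n : root_bound n <= root_bound (S n).
Proof.
  induction n as [|n IH]; [simpl; lra|].
  change (/ 2 * (1 + root_bound n ^ 2) <= / 2 * (1 + root_bound (S n) ^ 2)).
  pose proof (root_bound_range n). pose proof (root_bound_range (S n)). nra.
Qed.

Lemma ip_zero_r x : ip x hzero = RtoC 0.
Proof. rewrite ip_conj, (form_zero_l _ ip_psd). apply Cconj_R. Qed.

Section RootIteration.

Context (A : L2 -> L2) (linA : linear A) (adjA : selfadjoint A).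
Context (contrA : forall x, nrm (A x) <= nrm x).

Lemma root_iter_linear n : linear (root_iter A n).
Proof.
  induction n as [|n IH]; split; intros; simpl.
  - apply L2_ext; intros; simpl; ring.
  - apply L2_ext; intros; simpl; ring.
  - rewrite (linear_add _ linA), !(linear_add _ IH). apply L2_ext; intros; simpl; ring.
  - rewrite (linear_scal _ linA), !(linear_scal _ IH). apply L2_ext; intros; simpl; ring.
Qed.

Lemma root_iter_selfadjoint n : selfadjoint (root_iter A n).
Proof.
  induction n as [|n IH]; intros x y; simpl.
  - now rewrite (form_zero_l _ ip_psd), ip_zero_r.
  - rewrite ip_scal_l, (form_scal_r _ ip_psd), Cconj_R, ip_add_l, (form_add_r _ ip_psd).
    now rewrite adjA, !IH.
Qed.

Lemma half_nrm x : nrm (hscal (RtoC (/ 2)) x) = / 2 * nrm x.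
Proof. rewrite nrm_scal, Cmod_R, Rabs_pos_eq; lra. Qed.

Lemma nrm_zero : nrm hzero = 0.
Proof. unfold nrm, nsq. rewrite (form_zero_l _ ip_psd). apply sqrt_0. Qed.

Lemma root_iter_bound n x : nrm (root_iter A n x) <= root_bound n * nrm x.
Proof.
  revert x; induction n as [|n IH]; intros x; simpl.
  - rewrite nrm_zero. pose proof (nrm_ge0 x). lra.
  - rewrite half_nrm. pose proof (nrm_triangle (A x) (root_iter A n (root_iter A n x))).
    pose proof (contrA x). pose proof (IH (root_iter A n x)). pose proof (IH x).
    pose proof (root_bound_range n). nra.
Qed.

(** From Y^2 - Z^2 = Y (Y - Z) + (Y - Z) Z for consecutive iterates Z, Y. *)
Lemma root_iter_step n x :
  nrm (hsub (root_iter A (S n) x) (root_iter A n x)) <= (root_bound (S n) - root_bound n) * nrm x.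
Proof.
  revert x; induction n as [|n IH]; intros x.
  - replace (hsub _ _) with (root_iter A 1 x) by (apply L2_ext; intros; simpl; ring).
    eapply Rle_trans; [apply root_iter_bound|]. simpl. pose proof (nrm_ge0 x). lra.
  - set (Y := root_iter A (S n)) in *. set (Z := root_iter A n) in *.
    change (root_iter A (S (S n)) x) with (hscal (RtoC (/ 2)) (hadd (A x) (Y (Y x)))).
    replace (hsub (hscal (RtoC (/ 2)) (hadd (A x) (Y (Y x)))) (Y x)) with
      (hscal (RtoC (/ 2)) (hadd (Y (hsub (Y x) (Z x))) (hsub (Y (Z x)) (Z (Z x))))).
    2:{ rewrite (linear_sub Y) by apply root_iter_linear.
        transitivity (hsub (hscal (RtoC (/ 2)) (hadd (A x) (Y (Y x))))
          (hscal (RtoC (/ 2)) (hadd (A x) (Z (Z x))))); [|reflexivity].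
        apply L2_ext; intros i; simpl; ring. }
    rewrite half_nrm.
    pose proof (nrm_triangle (Y (hsub (Y x) (Z x))) (hsub (Y (Z x)) (Z (Z x)))).
    pose proof (root_iter_bound (S n) (hsub (Y x) (Z x))) as B1. fold Y in B1.
    pose proof (root_iter_bound n x) as B2. fold Z in B2.
    pose proof (IH x) as B3. pose proof (IH (Z x)) as B4.
    pose proof (root_bound_range n). pose proof (root_bound_range (S n)). pose proof (root_bound_incr n).
    replace (root_bound (S (S n)) - root_bound (S n)) with
      (/ 2 * (root_bound (S n) * (root_bound (S n) - root_bound n) + (root_bound (S n) - root_bound n) * root_bound n))
      by (assert (root_bound (S n) = / 2 * (1 + root_bound n ^ 2)) by reflexivity;
          change (root_bound (S (S n))) with (/ 2 * (1 + root_bound (S n) ^ 2)); lra).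
    set (a := root_bound n) in *. set (b := root_bound (S n)) in *.
    assert (nrm (Y (hsub (Y x) (Z x))) <= b * ((b - a) * nrm x))
      by (eapply Rle_trans; [exact B1 | apply Rmult_le_compat_l; [lra | exact B3]]).
    assert (nrm (hsub (Y (Z x)) (Z (Z x))) <= (b - a) * (a * nrm x))
      by (eapply Rle_trans; [exact B4 | apply Rmult_le_compat_l; [lra | exact B2]]).
    lra.
Qed.

Lemma root_iter_cauchy n m x : (n <= m)%nat ->
  nrm (hsub (root_iter A m x) (root_iter A n x)) <= (root_bound m - root_bound n) * nrm x.
Proof.
  intros Hm. replace m with ((m - n) + n)%nat by lia. generalize (m - n)%nat as d. clear m Hm.
  induction d as [|d IH].
  - replace (hsub _ _) with hzero by (apply L2_ext; intros; simpl; ring). simpl. rewrite nrm_zero.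
    right; ring.
  - eapply Rle_trans; [apply (nrm_sub_triangle _ (root_iter A (d + n) x))|].
    pose proof (root_iter_step (d + n) x). change (S d + n)%nat with (S (d + n)). lra.
Qed.

Lemma squeeze_0 (r : nat -> R) a c : is_lim_seq r 0 -> (forall n, a <= c * r n) -> a <= 0.
Proof.
  intros Hr Ha. replace 0 with (c * 0) by ring.
  apply (is_lim_seq_ge_const (fun n => c * r n)); auto. now apply (is_lim_seq_scal_l _ _ (Finite 0)).
Qed.

(** The iterates form a Cauchy sequence at each vector x, with errors at most (s - s_n) |x| for s
    the limit of the scalar majorants s_n; every identity is obtained from the one satisfied by the
    iterates with an error proportional to s - s_n. *)
Theorem root_equation : exists Y : L2 -> L2, linear Y /\ selfadjoint Y /\
  (forall x, nrm (Y x) <= nrm x) /\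
  (forall x, Y (Y x) = hsub (hscal 2 (Y x)) (A x)).
Proof.
  destruct (ex_finite_lim_seq_incr root_bound 1 root_bound_incr (fun n => proj2 (root_bound_range n)))
    as [s Hs].
  assert (Hle : forall n, root_bound n <= s)
    by (intros n; apply (is_lim_seq_incr_compare _ _ Hs root_bound_incr)).
  set (r := fun n => s - root_bound n).
  assert (Hr : is_lim_seq r 0).
  { unfold r. replace 0 with (s - s) by ring. apply is_lim_seq_minus'; [apply is_lim_seq_const | exact Hs]. }
  assert (Hex : forall x, exists y, forall n, nrm (hsub (root_iter A n x) y) <= r n * nrm x).
  { intros x. apply L2_complete.
    - rewrite <- (Rmult_0_l (nrm x)).
      apply (is_lim_seq_mult' r (fun _ => nrm x)); [exact Hr | apply is_lim_seq_const].
    - intros n m Hnm. eapply Rle_trans; [now apply root_iter_cauchy|].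
      apply Rmult_le_compat_r; [apply nrm_ge0|]. unfold r. specialize (Hle m). lra. }
  set (Y := fun x => proj1_sig (constructive_indefinite_description _ (Hex x))).
  assert (HY : forall x n, nrm (hsub (root_iter A n x) (Y x)) <= r n * nrm x).
  { intros x. unfold Y. exact (proj2_sig (constructive_indefinite_description _ (Hex x))). }
  assert (HY' : forall x n, nrm (hsub (Y x) (root_iter A n x)) <= r n * nrm x).
  { intros x n. rewrite nrm_sub_sym. apply HY. }
  assert (bndY : forall x, nrm (Y x) <= nrm x).
  { intros x. cut (nrm (Y x) - nrm x <= 0); [lra|]. apply (squeeze_0 r _ (nrm x) Hr). intros n.
    pose proof (nrm_triangle (hsub (Y x) (root_iter A n x)) (root_iter A n x)) as T.
    replace (hadd (hsub (Y x) (root_iter A n x)) (root_iter A n x)) with (Y x) in T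
      by (apply L2_ext; intros; simpl; ring).
    pose proof (HY' x n). pose proof (root_iter_bound n x). pose proof (root_bound_range n).
    pose proof (nrm_ge0 x). nra. }
  assert (linY : linear Y).
  { split.
    - intros x y. apply nrm_sub_0, (squeeze_0 r _ (nrm (hadd x y) + nrm x + nrm y) Hr). intros n.
      replace (hsub (Y (hadd x y)) (hadd (Y x) (Y y))) with
        (hadd (hsub (Y (hadd x y)) (root_iter A n (hadd x y)))
          (hadd (hsub (root_iter A n x) (Y x)) (hsub (root_iter A n y) (Y y))))
        by (rewrite (linear_add _ (root_iter_linear n)); apply L2_ext; intros; simpl; ring).
      eapply Rle_trans; [apply nrm_triangle|].
      eapply Rle_trans; [apply Rplus_le_compat_l, nrm_triangle|].
      pose proof (HY' (hadd x y) n). pose proof (HY x n). pose proof (HY y n). lra.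
    - intros c x. apply nrm_sub_0, (squeeze_0 r _ (nrm (hscal c x) + Cmod c * nrm x) Hr). intros n.
      replace (hsub (Y (hscal c x)) (hscal c (Y x))) with
        (hadd (hsub (Y (hscal c x)) (root_iter A n (hscal c x)))
          (hscal c (hsub (root_iter A n x) (Y x))))
        by (rewrite (linear_scal _ (root_iter_linear n)); apply L2_ext; intros; simpl; ring).
      eapply Rle_trans; [apply nrm_triangle|]. rewrite (nrm_scal c (hsub _ _)).
      pose proof (HY' (hscal c x) n). pose proof (HY x n). pose proof (Cmod_ge_0 c). nra. }
  exists Y. split; [exact linY|]. split; [|split; [exact bndY|]].
  - intros x y. assert (Z : Cmod (ip (Y x) y - ip x (Y y))%C <= 0).
    { apply (squeeze_0 r _ (2 * nrm x * nrm y) Hr). intros n.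
      replace (ip (Y x) y - ip x (Y y))%C with
        (ip (hsub (Y x) (root_iter A n x)) y + ip x (hsub (root_iter A n y) (Y y)))%C.
      2:{ rewrite (form_sub_l _ ip_psd), (form_sub_r _ ip_psd), (root_iter_selfadjoint n x y). ring. }
      eapply Rle_trans; [apply Cmod_triangle|].
      pose proof (cauchy_schwarz (hsub (Y x) (root_iter A n x)) y).
      pose proof (cauchy_schwarz x (hsub (root_iter A n y) (Y y))).
      pose proof (HY' x n). pose proof (HY y n). pose proof (nrm_ge0 x). pose proof (nrm_ge0 y). nra. }
    assert (E : (ip (Y x) y - ip x (Y y))%C = RtoC 0)
      by (apply Cmod_eq_0, Rle_antisym; [exact Z | apply Cmod_ge_0]).
    replace (ip (Y x) y) with ((ip (Y x) y - ip x (Y y)) + ip x (Y y))%C by ring. rewrite E. ring.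
  - intros x. apply nrm_sub_0, (squeeze_0 (fun n => r n + r (S n)) _ (2 * nrm x)).
    { replace 0 with (0 + 0) by ring. apply is_lim_seq_plus'; [exact Hr | now apply is_lim_seq_incr_1 in Hr]. }
    intros n.
    replace (hsub (Y (Y x)) (hsub (hscal 2 (Y x)) (A x))) with
      (hadd (Y (hsub (Y x) (root_iter A n x)))
        (hadd (hsub (Y (root_iter A n x)) (root_iter A n (root_iter A n x)))
          (hscal 2 (hsub (root_iter A (S n) x) (Y x))))).
    2:{ rewrite (linear_sub Y _ _ linY). apply L2_ext; intros i. simpl. rewrite RtoC_inv by lra. field. }
    eapply Rle_trans; [apply nrm_triangle|].
    eapply Rle_trans; [apply Rplus_le_compat_l, nrm_triangle|]. rewrite nrm_scal, Cmod_R, Rabs_pos_eq by lra.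
    pose proof (bndY (hsub (Y x) (root_iter A n x))). pose proof (HY' x n).
    pose proof (HY' (root_iter A n x) n). pose proof (HY x (S n)).
    pose proof (root_iter_bound n x). pose proof (root_bound_range n). pose proof (nrm_ge0 x).
    assert (0 <= r n) by (unfold r; specialize (Hle n); lra).
    assert (nrm (root_iter A n x) <= nrm x) by nra. nra.
Qed.

End RootIteration.

(** After rescaling T to a contraction, A = 1 - T^*T is a self-adjoint contraction, and P = 1 - Y for
    the solution Y of 2Y = A + Y^2. *)
Theorem absolute_value_exists (T S : L2 -> L2) c : 0 < c -> linear T -> linear S ->
  (forall x y, ip (T x) y = ip x (S y)) ->
  (forall x, nrm (T x) <= c * nrm x) -> (forall x, nrm (S x) <= c * nrm x) ->
  exists P : L2 -> L2, linear P /\ selfadjoint P /\ (forall x, 0 <= Re (ip (P x) x)) /\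
    (forall x, nrm (P x) <= 2 * c * nrm x) /\ (forall x, P (P x) = S (T x)).
Proof.
  intros Hc LT LS Hadj HT HS.
  set (k := / c ^ 2).
  assert (Hk : 0 < k) by (apply Rinv_0_lt_compat, pow_lt; lra).
  assert (Hkc : k * c ^ 2 = 1) by (unfold k; field; lra).
  set (A := fun x => hsub x (hscal (RtoC k) (S (T x)))).
  assert (adjST : forall x y, ip (S (T x)) y = ip x (S (T y))).
  { intros x y. rewrite <- Hadj, (ip_conj y (S (T x))), <- Hadj, <- ip_conj. reflexivity. }
  destruct (root_equation A) as [Y [LY [SY [BY EY]]]].
  - split; intros; unfold A.
    + rewrite (linear_add _ LT), (linear_add _ LS). apply L2_ext; intros; simpl; ring.
    + rewrite (linear_scal _ LT), (linear_scal _ LS). apply L2_ext; intros; simpl; ring.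
  - intros x y. unfold A. rewrite (form_sub_l _ ip_psd), (form_sub_r _ ip_psd), ip_scal_l, (form_scal_r _ ip_psd), Cconj_R.
    now rewrite adjST.
  - intros x. apply nrm_le; [apply nrm_ge0|]. rewrite nrm_sq.
    assert (E : nsq (A x) = nsq x - 2 * k * nsq (T x) + k ^ 2 * nsq (S (T x))).
    { assert (E1 : ip x (S (T x)) = RtoC (nsq (T x))) by (rewrite <- Hadj; apply (form_self _ ip_psd)).
      assert (E2 : ip (S (T x)) x = RtoC (nsq (T x))) by (now rewrite ip_conj, E1, Cconj_R).
      unfold nsq at 1. unfold A.
      rewrite (form_sub_l _ ip_psd), !(form_sub_r _ ip_psd), !ip_scal_l, !(form_scal_r _ ip_psd), Cconj_R, E1, E2.
      rewrite (form_self _ ip_psd (S (T x))), (form_self _ ip_psd x). fold (nsq x) (nsq (S (T x))).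
      rewrite <- !RtoC_mult, <- !RtoC_minus. simpl. ring. }
    rewrite E. pose proof (HS (T x)) as B. pose proof (nrm_ge0 (S (T x))).
    assert (B2 : nsq (S (T x)) <= c ^ 2 * nsq (T x)).
    { rewrite <- !nrm_sq, <- Rpow_mult_distr. now apply pow_incr. }
    assert (k ^ 2 * nsq (S (T x)) <= k * nsq (T x)).
    { replace (k * nsq (T x)) with (k ^ 2 * (c ^ 2 * nsq (T x))).
      - apply Rmult_le_compat_l; [apply pow2_ge_0 | exact B2].
      - replace (k ^ 2 * (c ^ 2 * nsq (T x))) with (k * (k * c ^ 2) * nsq (T x)) by ring. rewrite Hkc. ring. }
    pose proof (nsq_ge0 (T x)). nra.
  - exists (fun x => hscal (RtoC c) (hsub x (Y x))).
    split; [|split; [|split; [|split]]].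
    + split; intros.
      * rewrite (linear_add _ LY). apply L2_ext; intros; simpl; ring.
      * rewrite (linear_scal _ LY). apply L2_ext; intros; simpl; ring.
    + intros x y. rewrite ip_scal_l, (form_scal_r _ ip_psd), Cconj_R, (form_sub_l _ ip_psd), (form_sub_r _ ip_psd).
      now rewrite SY.
    + intros x. rewrite ip_scal_l, (form_sub_l _ ip_psd), (form_self _ ip_psd x). fold (nsq x).
      pose proof (cauchy_schwarz (Y x) x) as B. pose proof (re_le_Cmod (ip (Y x) x)) as B'.
      pose proof (Rle_abs (Re (ip (Y x) x))). pose proof (BY x). pose proof (nrm_ge0 x).
      pose proof (nrm_sq x).
      assert (Re (ip (Y x) x) <= nsq x) by nra.
      replace (Re (RtoC c * (RtoC (nsq x) - ip (Y x) x))%C) with (c * (nsq x - Re (ip (Y x) x)))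
        by (unfold Re; simpl; ring). apply Rmult_le_pos; lra.
    + intros x. rewrite nrm_scal, Cmod_R, Rabs_pos_eq by lra. rewrite (Rmult_comm 2), Rmult_assoc.
      apply Rmult_le_compat_l; [lra|]. unfold hsub. eapply Rle_trans; [apply nrm_triangle|].
      rewrite nrm_scal, Cmod_R, Rabs_left by lra. specialize (BY x). lra.
    + intros x. rewrite (linear_scal _ LY), (linear_sub _ _ _ LY), EY. apply L2_ext; intros i.
      unfold A. simpl. 
      replace (coord (S (T x)) i) with (RtoC (k * c ^ 2) * coord (S (T x)) i)%C at 2 by (rewrite Hkc; ring).
      rewrite RtoC_mult, RtoC_pow. ring.
Qed.

(** * Nuclear matrices define trace class operators *)

Definition cutoff (n : nat) (x : nat -> C) (i : nat) : C := if Nat.ltb i n then x i else RtoC 0.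

Lemma cutoff_ell2 n x : ell2 (cutoff n x).
Proof. apply (ell2_finite n). intros i Hi. unfold cutoff. now rewrite (proj2 (Nat.ltb_ge _ _)). Qed.

Definition finite_vec (n : nat) (x : nat -> C) : L2 := exist _ _ (cutoff_ell2 n x).

Lemma finite_coord n x i : (i < n)%nat -> finite_vec n x i = x i.
Proof. intros Hi. simpl. unfold cutoff. now rewrite (proj2 (Nat.ltb_lt _ _)). Qed.

Lemma ip_finite n x (y : L2) : ip (finite_vec n x) y = csum n (fun i => (x i * Cconj (y i))%C).
Proof.
  eapply converges_unique; [apply ip_converges|]. apply (converges_eventually _ _ n). intros m Hm.
  rewrite (csum_widen n m); auto.
  - apply csum_ext; intros i Hi. now rewrite finite_coord.
  - intros i Hi. simpl. unfold cutoff. rewrite (proj2 (Nat.ltb_ge _ _)) by lia. ring.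
Qed.

Lemma nsq_finite n x : nsq (finite_vec n x) = rsum n (fun i => Cmod (x i) ^ 2).
Proof.
  unfold nsq. rewrite ip_finite.
  rewrite (csum_ext n _ (fun i => RtoC (Cmod (x i) ^ 2))).
  - rewrite csum_RtoC. reflexivity.
  - intros i Hi. rewrite finite_coord, Cmod2_conj by auto. reflexivity.
Qed.

Lemma csum_cauchy_schwarz n x y :
  Cmod (csum n (fun i => (x i * y i)%C)) ^ 2 <=
  rsum n (fun i => Cmod (x i) ^ 2) * rsum n (fun i => Cmod (y i) ^ 2).
Proof.
  pose proof (form_cauchy_schwarz ip ip_psd (finite_vec n x) (finite_vec n (fun i => Cconj (y i)))) as P.
  change (Re (ip (finite_vec n x) (finite_vec n x))) with (nsq (finite_vec n x)) in P.
  match type of P with _ <= _ * Re (ip ?u ?u) => change (Re (ip u u)) with (nsq u) in P end.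
  rewrite !nsq_finite, ip_finite in P.
  rewrite (csum_ext n _ (fun i => (x i * y i)%C)) in P.
  - rewrite (rsum_ext n (fun i => Cmod (Cconj (y i)) ^ 2) (fun i => Cmod (y i) ^ 2)) in P; auto.
    intros; now rewrite Cmod_conj.
  - intros i Hi. rewrite finite_coord, Cconj_conj by auto. reflexivity.
Qed.

Lemma pairing_rank_one n (x y a b : nat -> C) :
  pairing n (fun i j => (x i * y j)%C) (fun i j => (a i * b j)%C) =
  (csum n (fun i => (x i * a i)%C) * csum n (fun j => (y j * b j)%C))%C.
Proof.
  rewrite Cmult_comm, <- csum_scal. apply csum_ext; intros i _.
  rewrite (Cmult_comm (csum _ _)), <- csum_scal. apply csum_ext; intros j _. ring.
Qed.

Lemma sqw_1 n x : weighted_sq n (fun _ => 1) x = rsum n (fun i => Cmod (x i) ^ 2).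
Proof. apply rsum_ext; intros; ring. Qed.

(** Finite Cauchy-Schwarz in both variables. *)
Lemma dominated_rank_one n x y p : 0 <= p ->
  rsum n (fun i => Cmod (x i) ^ 2) * rsum n (fun i => Cmod (y i) ^ 2) <= p ^ 2 ->
  dominated n (fun i j => (x i * y j)%C) (fun _ => p).
Proof.
  intros Hp Hxy a b. rewrite pairing_rank_one, Cmod_mult.
  assert (E : forall z, weighted_sq n (fun _ => p) z = p * rsum n (fun i => Cmod (z i) ^ 2))
    by (intros z; unfold weighted_sq; now rewrite <- rsum_scal).
  rewrite !E. pose proof (csum_cauchy_schwarz n x a) as B1. pose proof (csum_cauchy_schwarz n y b) as B2.
  set (u := Cmod (csum n (fun i => (x i * a i)%C))) in *. set (v := Cmod (csum n (fun j => (y j * b j)%C))) in *.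
  assert (0 <= u) by apply Cmod_ge_0. assert (0 <= v) by apply Cmod_ge_0.
  assert (G : forall z, 0 <= rsum n (fun i => Cmod (z i) ^ 2))
    by (intros; apply rsum_ge0; intros; apply Cmod2_ge0).
  pose proof (G x) as Gx; pose proof (G y) as Gy; pose proof (G a) as Ga; pose proof (G b) as Gb.
  set (X := rsum n (fun i => Cmod (x i) ^ 2)) in *. set (Y := rsum n (fun i => Cmod (y i) ^ 2)) in *.
  set (A := rsum n (fun i => Cmod (a i) ^ 2)) in *. set (B := rsum n (fun i => Cmod (b i) ^ 2)) in *.
  assert (K : (u * v) ^ 2 <= p ^ 2 * (A * B)).
  { replace ((u * v) ^ 2) with (u ^ 2 * v ^ 2) by ring.
    apply Rle_trans with ((X * A) * (Y * B)).
    - apply Rmult_le_compat; auto; apply pow2_ge_0.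
    - replace (X * A * (Y * B)) with ((X * Y) * (A * B)) by ring.
      apply Rmult_le_compat_r; auto. now apply Rmult_le_pos. }
  apply Rsqr_incr_0_var; [|nra]. rewrite !Rsqr_pow2.
  replace ((2 * (u * v)) ^ 2) with (4 * (u * v) ^ 2) by ring.
  replace ((p * A + p * B) ^ 2) with (4 * (p ^ 2 * (A * B)) + p ^ 2 * (A - B) ^ 2) by ring.
  assert (0 <= p ^ 2 * (A - B) ^ 2) by (apply Rmult_le_pos; apply pow2_ge_0). lra.
Qed.

(** The nuclear bound restricted to the rank one matrices of norm at most p: this is boundedness of
    the bilinear form of M, the part of nuclearity that produces an operator. *)
Definition rank_one_bounded (c : R) (M : nat -> nat -> C) : Prop :=
  forall n x y p, 0 < p ->
    rsum n (fun i => Cmod (x i) ^ 2) * rsum n (fun i => Cmod (y i) ^ 2) <= p ^ 2 ->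
    Cmod (pairing n (fun i j => (x i * y j)%C) M) <= p * c.

Lemma rank_one_bounded_adjoint c M :
  rank_one_bounded c M -> rank_one_bounded c (fun i j => Cconj (M j i)).
Proof.
  intros HM n x y p Hp Hxy.
  assert (E : forall z, rsum n (fun i => Cmod (Cconj (z i)) ^ 2) = rsum n (fun i => Cmod (z i) ^ 2))
    by (intros; apply rsum_ext; intros; now rewrite Cmod_conj).
  specialize (HM n (fun i => Cconj (y i)) (fun i => Cconj (x i)) p Hp).
  cbv beta in HM. rewrite (E x), (E y), Rmult_comm in HM. specialize (HM Hxy).
  rewrite <- Cmod_conj. unfold pairing in *. rewrite csum_conj.
  erewrite csum_ext; [|intros i _; rewrite csum_conj; reflexivity].
  rewrite csum_swap. rewrite (csum_ext n _ (fun i => csum n (fun j => (Cconj (y i) * Cconj (x j) * M i j)%C))); auto.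
  intros i _. apply csum_ext; intros j _. rewrite !Cmult_conj, Cconj_conj. ring.
Qed.

(** Test the form at y = conj(Mx); the scale p = (V/c + c a)/2, with V = |Mx|^2 and a = |x|^2, is at
    least the geometric mean of V and a. *)
Lemma rank_one_bounded_image c M n m x : 0 < c -> rank_one_bounded c M ->
  rsum n (fun i => Cmod (csum m (fun j => (M i j * x j)%C)) ^ 2) <=
  c ^ 2 * rsum m (fun j => Cmod (x j) ^ 2).
Proof.
  intros Hc HM. set (v := fun i => csum m (fun j => (M i j * x j)%C)).
  set (V := rsum n (fun i => Cmod (v i) ^ 2)). set (a := rsum m (fun j => Cmod (x j) ^ 2)).
  assert (HV : 0 <= V) by (apply rsum_ge0; intros; apply Cmod2_ge0).
  assert (Ha : 0 <= a) by (apply rsum_ge0; intros; apply Cmod2_ge0).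
  change (V <= c ^ 2 * a).
  destruct (Rle_lt_or_eq_dec _ _ HV) as [HV'|<-]; [|apply Rmult_le_pos; auto; apply pow2_ge_0].
  assert (Hcut : forall k z, (k <= n + m)%nat ->
     rsum (n + m) (fun i => Cmod (cutoff k z i) ^ 2) = rsum k (fun i => Cmod (z i) ^ 2)).
  { intros k z Hk. rewrite (rsum_widen k (n + m)); auto.
    - apply rsum_ext; intros i Hi. unfold cutoff. now rewrite (proj2 (Nat.ltb_lt _ _)).
    - intros i Hi. unfold cutoff. rewrite (proj2 (Nat.ltb_ge _ _)) by lia. rewrite Cmod_0. ring. }
  assert (Hca : 0 <= c * a) by (apply Rmult_le_pos; lra).
  assert (HVc : 0 < V / c) by (apply Rdiv_lt_0_compat; lra).
  specialize (HM (n + m)%nat (cutoff n (fun i => Cconj (v i))) (cutoff m x) ((V / c + c * a) / 2)).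
  rewrite !Hcut in HM by lia.
  rewrite (rsum_ext n _ (fun i => Cmod (v i) ^ 2)) in HM by (intros; now rewrite Cmod_conj).
  fold V a in HM.
  assert (E : pairing (n + m) (fun i j => (cutoff n (fun i => Cconj (v i)) i * cutoff m x j)%C) M = RtoC V).
  { unfold pairing. rewrite (csum_widen n (n + m)); [|lia|].
    - unfold V. rewrite <- csum_RtoC. apply csum_ext; intros i Hi.
      rewrite (csum_widen m (n + m)); [|lia|].
      + rewrite Cmod2_conj, Cmult_comm. unfold v at 3. rewrite <- csum_scal.
        apply csum_ext; intros j Hj. unfold cutoff. rewrite !(proj2 (Nat.ltb_lt _ _)) by auto. ring.
      + intros j Hj. unfold cutoff at 2. rewrite (proj2 (Nat.ltb_ge _ _)) by lia. ring.
    - intros i Hi. apply csum_0; intros j _. unfold cutoff at 1. rewrite (proj2 (Nat.ltb_ge _ _)) by lia. ring. }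
  rewrite E, Cmod_R, Rabs_pos_eq in HM by lra.
  assert (B : V <= (V / c + c * a) / 2 * c).
  { apply HM; [lra|]. replace (V * a) with ((V / c) * (c * a)) by (field; lra).
    pose proof (pow2_ge_0 (V / c - c * a)). lra. }
  replace ((V / c + c * a) / 2 * c) with ((V + c ^ 2 * a) / 2) in B by (field; lra). lra.
Qed.

(** Apply the bound on images to the conjugate of the row itself. *)
Lemma rank_one_bounded_row c M i n : 0 < c -> rank_one_bounded c M ->
  rsum n (fun j => Cmod (Cconj (M i j)) ^ 2) <= c ^ 2.
Proof.
  intros Hc HM. pose proof (rank_one_bounded_image c M (S i) n (fun j => Cconj (M i j)) Hc HM) as P.
  set (s := rsum n (fun j => Cmod (Cconj (M i j)) ^ 2)) in *.
  assert (E : csum n (fun j => (M i j * Cconj (M i j))%C) = RtoC s).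
  { unfold s. rewrite <- csum_RtoC. apply csum_ext; intros j _. now rewrite Cmod_conj, Cmod2_conj. }
  cbn [rsum] in P. rewrite E, Cmod_R, pow2_abs in P.
  assert (0 <= rsum i (fun i0 => Cmod (csum n (fun j => (M i0 j * Cconj (M i j))%C)) ^ 2))
    by (apply rsum_ge0; intros; apply Cmod2_ge0).
  assert (0 <= s) by (apply rsum_ge0; intros; apply Cmod2_ge0).
  (* The row i of the image of conj(M_i) is s, so s^2 <= c^2 s. *)
  destruct (Rle_lt_dec s (c ^ 2)); auto. nra.
Qed.

Lemma matrix_operator c M : 0 < c -> rank_one_bounded c M ->
  exists (T : L2 -> L2) (row : nat -> L2), linear T /\ (forall i j, row i j = Cconj (M i j)) /\
    (forall x i, T x i = ip x (row i)) /\ (forall x, nrm (T x) <= c * nrm x).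
Proof.
  intros Hc HM.
  set (row := fun i => exist _ _ (ell2_bounded _ _ (fun n => rank_one_bounded_row c M i n Hc HM)) : L2).
  assert (Himg : forall (x : L2) n, rsum n (fun i => Cmod (ip x (row i)) ^ 2) <= c ^ 2 * nsq x).
  { intros x n.
    apply (is_lim_seq_le_const (fun m => rsum n (fun i => Cmod (csum m (fun j => (x j * Cconj (row i j))%C)) ^ 2))).
    - apply (rsum_lim n (fun m i => Cmod (csum m (fun j => (x j * Cconj (row i j))%C)) ^ 2)).
      intros i. apply converges_Cmod2, ip_converges.
    - intros m. eapply Rle_trans; [|apply Rmult_le_compat_l; [apply pow2_ge_0 | apply (rsum_le_nsq x m)]].
      eapply Rle_trans; [|apply (rank_one_bounded_image c M n m x Hc HM)].
      right. apply rsum_ext; intros i _. do 2 f_equal. apply csum_ext; intros j _.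
      simpl. rewrite Cconj_conj. ring. }
  set (T := fun x : L2 => exist _ _ (ell2_bounded _ _ (Himg x)) : L2).
  exists T, row. split; [|split; [|split]].
  - split; intros; apply L2_ext; intros i; simpl; [apply ip_add_l | apply ip_scal_l].
  - reflexivity.
  - reflexivity.
  - intros x. apply nrm_le; [apply Rmult_le_pos; [lra | apply nrm_ge0]|].
    rewrite Rpow_mult_distr, nrm_sq. apply nsq_le, Himg.
Qed.

(** Both sides are continuous and conjugate linear in y, and finitely supported vectors are dense. *)
Lemma adjoint_extends (T S : L2 -> L2) c : linear S ->
  (forall x, nrm (S x) <= c * nrm x) ->
  (forall x i, ip (T x) (unit_vec i) = ip x (S (unit_vec i))) ->
  forall x y, ip (T x) y = ip x (S y).
Proof.
  intros LS BS HTS x y.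
  assert (Hfin : forall n, ip (T x) (trunc n y) = ip x (S (trunc n y))).
  { intros n. unfold trunc. rewrite (linear_sum _ _ _ LS), !(form_sum_r _ ip_psd).
    apply csum_ext; intros i _. now rewrite (linear_scal _ LS), !(form_scal_r _ ip_psd), HTS. }
  assert (Z : Cmod (ip (T x) y - ip x (S y))%C <= 0).
  { apply (squeeze_0 (fun n => nrm (hsub y (trunc n y))) _ (nrm (T x) + c * nrm x) (trunc_lim y)). intros n.
    replace (ip (T x) y - ip x (S y))%C with
      (ip (T x) (hsub y (trunc n y)) - ip x (S (hsub y (trunc n y))))%C
      by (rewrite (linear_sub _ _ _ LS), !(form_sub_r _ ip_psd), Hfin; ring).
    eapply Rle_trans; [apply Cmod_triangle|]. rewrite Cmod_opp.
    pose proof (cauchy_schwarz (T x) (hsub y (trunc n y))).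
    pose proof (cauchy_schwarz x (S (hsub y (trunc n y)))).
    pose proof (BS (hsub y (trunc n y))). pose proof (nrm_ge0 x). nra. }
  replace (ip (T x) y) with ((ip (T x) y - ip x (S y)) + ip x (S y))%C by ring.
  rewrite (Cmod_eq_0 (ip (T x) y - ip x (S y))%C); [ring|].
  apply Rle_antisym; [exact Z | apply Cmod_ge_0].
Qed.

(** Gram-Schmidt for <Px,Py> = <Tx,Ty> makes the g_k = P f_k and the h_k = T f_k orthonormal (up to
    zero vectors), and P e_j = sum_k <T e_j, h_k> g_k for j < n.  Hence the partial trace is the pairing
    of the matrix of T with X_ij = sum_k conj(h_k(i)) g_k(j), a contraction by Bessel.  The row index i
    is unbounded, so the finite pairings only reach the trace in the limit. *)
Lemma absolute_value_trace_le (T P : L2 -> L2) c : linear P -> linear T ->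
  (forall x y, ip (P x) (P y) = ip (T x) (T y)) ->
  (forall n X, dominated n X (fun _ => 1) -> Cmod (pairing n X (fun i j => T (unit_vec j) i)) <= c) ->
  forall n, Cmod (csum n (fun j => ip (P (unit_vec j)) (unit_vec j))) <= c.
Proof.
  intros LP LT Hiso Hc n.
  assert (HQ : psd (fun x y => ip (P x) (P y))).
  { split.
    - intros x y z. now rewrite (linear_add _ LP), ip_add_l.
    - intros a x z. now rewrite (linear_scal _ LP), ip_scal_l.
    - intros x y. apply ip_conj.
    - intros x. apply nsq_ge0. }
  set (Q := fun x y => ip (P x) (P y)) in *.
  destruct (gram_schmidt Q HQ unit_vec n) as [f [Ho [Hn He]]].
  set (g := fun k => P (f k)). set (h := fun k => T (f k)).
  assert (Hexp : forall j, (j < n)%nat -> ip (P (unit_vec j)) (unit_vec j) =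
     csum n (fun k => (g k j * ip (T (unit_vec j)) (h k))%C)).
  { intros j Hj. specialize (He j Hj). apply nsq_0 in He.
    rewrite (linear_sub _ _ _ LP) in He. unfold expansion in He. rewrite (linear_sum _ _ _ LP) in He.
    apply (f_equal (fun z : L2 => z j)) in He. simpl in He. rewrite hsum_coord in He.
    rewrite ip_unit.
    replace (P (unit_vec j) j) with (P (unit_vec j) j + RtoC (-1) * csum n (fun k => P (hscal (Q (unit_vec j) (f k)) (f k)) j)
         + csum n (fun k => P (hscal (Q (unit_vec j) (f k)) (f k)) j))%C by ring.
    rewrite He, Cplus_0_l. apply csum_ext; intros k _. rewrite (linear_scal _ LP). simpl.
    unfold Q, h. rewrite Hiso. unfold g. ring. }
  set (X := fun i j => if Nat.ltb j n then csum n (fun k => (Cconj (h k i) * g k j)%C) else RtoC 0).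
  assert (Hdom : forall N, (n <= N)%nat -> dominated N X (fun _ => 1)).
  { intros N HN x y. rewrite !sqw_1.
    assert (E : pairing N X (fun i j => (x i * y j)%C) =
      csum n (fun k => (ip (finite_vec N x) (h k) * Cconj (ip (finite_vec n (fun j => Cconj (y j))) (g k)))%C)).
    { rewrite (csum_ext n _ (fun k => csum N (fun i => csum n (fun j =>
        (Cconj (h k i) * g k j * (x i * y j))%C)))).
      2:{ intros k _. rewrite !ip_finite, csum_conj, Cmult_comm, <- csum_scal. apply csum_ext; intros i _.
          rewrite Cmult_comm, <- csum_scal. apply csum_ext; intros j _.
          rewrite Cmult_conj, !Cconj_conj. ring. }
      rewrite csum_swap. apply csum_ext; intros i _. rewrite csum_swap.
      rewrite (csum_widen n N); auto.
      - apply csum_ext; intros j Hj. unfold X. rewrite (proj2 (Nat.ltb_lt _ _)) by auto.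
        rewrite Cmult_comm, <- csum_scal. apply csum_ext; intros; ring.
      - intros j Hj. unfold X. rewrite (proj2 (Nat.ltb_ge _ _)) by lia. ring. }
    assert (Bg : rsum n (fun k => Cmod (ip (finite_vec n (fun j => Cconj (y j))) (g k)) ^ 2) <= rsum n (fun j => Cmod (y j) ^ 2)).
    { eapply Rle_trans; [apply (form_bessel ip ip_psd); [exact Ho | exact Hn]|].
      change (Re (ip ?u ?u)) with (nsq u). rewrite nsq_finite. right. apply rsum_ext; intros; now rewrite Cmod_conj. }
    assert (Bh : rsum n (fun k => Cmod (ip (finite_vec N x) (h k)) ^ 2) <= rsum N (fun i => Cmod (x i) ^ 2)).
    { eapply Rle_trans; [apply (form_bessel ip ip_psd)|].
      - intros k l Hk Hl Hkl. unfold h. rewrite <- Hiso. now apply Ho.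
      - intros k Hk. unfold h. rewrite <- Hiso. now apply Hn.
      - change (Re (ip ?u ?u)) with (nsq u). rewrite nsq_finite. lra. }
    pose proof (rsum_mono n N (fun j => Cmod (y j) ^ 2) HN (fun j => Cmod2_ge0 _)) as Bm.
    rewrite E. eapply Rle_trans; [apply Rmult_le_compat_l; [lra | apply Cmod_csum]|].
    rewrite <- rsum_scal.
    eapply Rle_trans; [|apply Rplus_le_compat; [exact Bh | eapply Rle_trans; [exact Bg | exact Bm]]].
    rewrite <- rsum_plus. apply rsum_le; intros k _. rewrite Cmod_mult, Cmod_conj.
    set (u := Cmod _). set (v := Cmod _). pose proof (pow2_ge_0 (u - v)). lra. }
  assert (Hlim : converges (fun N => pairing (N + n) X (fun i j => T (unit_vec j) i))
      (csum n (fun j => ip (P (unit_vec j)) (unit_vec j)))).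
  { rewrite (csum_ext n _ (fun j => csum n (fun k => (g k j * ip (T (unit_vec j)) (h k))%C))) by exact Hexp.
    apply converges_ext with (fun N => csum n (fun j => csum n (fun k =>
       (g k j * csum (N + n) (fun i => (T (unit_vec j) i * Cconj (h k i))%C))%C))).
    - intros N. symmetry. unfold pairing. rewrite csum_swap, (csum_widen n (N + n)); [|lia|]. symmetry.
      + apply csum_ext; intros j Hj.
        erewrite csum_ext; [|intros k _; rewrite <- csum_scal; reflexivity].
        rewrite csum_swap. apply csum_ext; intros i _. unfold X. rewrite (proj2 (Nat.ltb_lt j n) Hj).
        rewrite Cmult_comm, <- csum_scal. apply csum_ext; intros; ring.
      + intros j Hj. apply csum_0; intros i _. unfold X. rewrite (proj2 (Nat.ltb_ge _ _)) by lia. ring.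
    - apply (csum_converges n (fun N j => csum n (fun k =>
       (g k j * csum (N + n) (fun i => (T (unit_vec j) i * Cconj (h k i))%C))%C))). intros j _.
      apply (csum_converges n (fun N k => (g k j * csum (N + n) (fun i => (T (unit_vec j) i * Cconj (h k i))%C))%C)).
      intros k _. apply converges_scal.
      destruct (ip_converges (T (unit_vec j)) (h k)) as [C1 C2].
      split; [apply (is_lim_seq_incr_n _ n) in C1; exact C1 | apply (is_lim_seq_incr_n _ n) in C2; exact C2]. }
  apply Rsqr_incr_0_var.
  2:{ eapply Rle_trans; [apply Cmod_ge_0 | apply (Hc n X); apply Hdom; lia]. }
  rewrite !Rsqr_pow2. apply (is_lim_seq_le_const _ _ _ (converges_Cmod2 _ _ Hlim)). intros N.
  apply pow_incr. split; [apply Cmod_ge_0|]. apply Hc, Hdom. lia.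
Qed.

(** Operators are total maps on sequences, so a value has to be chosen outside of the square summable
    ones. *)
Definition extend_operator (A : L2 -> L2) (x : nat -> C) : nat -> C :=
  match excluded_middle_informative (ell2 x) with
  | left h => A (exist _ x h)
  | right _ => fun _ => RtoC 0
  end.

Lemma extend_exist A x (h : ell2 x) : extend_operator A x = A (exist _ x h).
Proof.
  unfold extend_operator. destruct excluded_middle_informative as [h'|]; [|contradiction].
  do 3 f_equal. apply proof_irrelevance.
Qed.

Lemma extend_coord A (x : L2) : extend_operator A x = A x.
Proof. rewrite (extend_exist A x (coord_ell2 x)). do 2 f_equal. now apply L2_ext. Qed.

Lemma extend_bounded A c : linear A -> (forall x, nrm (A x) <= c * nrm x) -> bounded_operator (extend_operator A).
Proof.
  intros LA BA. split.
  - intros x h. rewrite (extend_exist A x h). apply coord_ell2.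
  - intros x y hx hy n. rewrite (extend_exist A x hx), (extend_exist A y hy).
    set (x' := exist _ x hx : L2). set (y' := exist _ y hy : L2).
    change (extend_operator A (coord (hadd x' y')) n = hadd (A x') (A y') n).
    now rewrite extend_coord, (linear_add _ LA).
  - intros a x hx n. rewrite (extend_exist A x hx). set (x' := exist _ x hx : L2).
    change (extend_operator A (coord (hscal a x')) n = hscal a (A x') n).
    now rewrite extend_coord, (linear_scal _ LA).
  - exists c. intros x hx. rewrite (extend_exist A x hx).
    pose proof (BA (exist _ x hx)) as B. rewrite !nrm_ell2_norm in B. exact B.
Qed.

Theorem nuclear_matrix_in_S1 M : nuclear M -> matrix_in_S1 M.
Proof.
  intros [c0 Hc0].
  (* A positive bound is needed to rescale the operator to a contraction. *)
  set (c := Rmax c0 1).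
  assert (Hc1 : 0 < c) by (unfold c; pose proof (Rmax_r c0 1); lra).
  assert (Hc : forall n X, dominated n X (fun _ => 1) -> Cmod (pairing n X M) <= c)
    by (intros n X HX; eapply Rle_trans; [exact (Hc0 n X HX) | apply Rmax_l]).
  assert (HM : rank_one_bounded c M).
  { intros n x y p Hp Hxy. apply dominated_pairing; auto. apply dominated_rank_one; [lra | exact Hxy]. }
  destruct (matrix_operator c M Hc1 HM) as [T [rowT [LT [ET [VT BT]]]]].
  destruct (matrix_operator c _ Hc1 (rank_one_bounded_adjoint c M HM)) as [S [rowS [LS [ES [VS BS]]]]].
  assert (HT : forall i j, T (unit_vec j) i = M i j).
  { intros i j. rewrite VT, ip_conj, ip_unit, ET, Cconj_conj. reflexivity. }
  assert (Hadj : forall x y, ip (T x) y = ip x (S y)).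
  { apply (adjoint_extends T S c LS BS). intros x i. rewrite ip_unit, VT. f_equal.
    apply L2_ext; intros j. now rewrite ET, VS, ip_conj, ip_unit, ES, Cconj_conj. }
  destruct (absolute_value_exists T S c Hc1 LT LS Hadj BT BS) as [P [LP [SP [PP [BP EP]]]]].
  assert (HtrC : forall n, Cmod (csum n (fun j => ip (P (unit_vec j)) (unit_vec j))) <= c).
  { apply (absolute_value_trace_le T P c LP LT).
    - intros x y. now rewrite <- (SP (P x) y), EP, Hadj, <- Hadj, ip_conj, <- Hadj, <- ip_conj.
    - intros n X HX. rewrite (pairing_ext n X X _ M); auto. intros; now rewrite HT. }
  assert (Bnd_T : bounded_operator (extend_operator T)) by exact (extend_bounded T c LT BT).
  assert (Bnd_S : bounded_operator (extend_operator S)) by exact (extend_bounded S c LS BS).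
  assert (Bnd_P : bounded_operator (extend_operator P)) by exact (extend_bounded P _ LP BP).
  exists (extend_operator T). split.
  - split; [exact Bnd_T|]. exists (extend_operator P). split.
    + split.
      * split; [exact Bnd_P|]. intros x hx. rewrite (extend_exist P x hx).
        set (x' := exist _ x hx : L2). change (Im (ip (P x') x') = 0 /\ 0 <= Re (ip (P x') x')).
        split; [|apply PP]. pose proof (f_equal Im (ip_conj (P x') x')) as E.
        rewrite <- SP, im_conj in E. lra.
      * exists (extend_operator S). split.
        -- split; [exact Bnd_S|]. intros x y hx hy. rewrite (extend_exist T x hx), (extend_exist S y hy).
           exact (Hadj (exist _ x hx) (exist _ y hy)).
        -- intros x hx n. rewrite (extend_exist T x hx), (extend_exist P x hx), !extend_coord. now rewrite EP.
    + assert (E : forall k, Re (inner (extend_operator P (basis k)) (basis k)) = Re (ip (P (unit_vec k)) (unit_vec k))).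
      { intros k. now rewrite (extend_exist P _ (basis_ell2 k)). }
      apply bounded_ex_series with c.
      * intros k. rewrite E. apply PP.
      * intros n. eapply Rle_trans; [|apply (HtrC n)]. eapply Rle_trans; [|apply re_le_Cmod].
        eapply Rle_trans; [|apply Rle_abs]. right.
        induction n as [|n IH]; [reflexivity|]. cbn [rsum csum]. rewrite IH, E. reflexivity.
  - intros i j. unfold matrix_of. rewrite (extend_exist T _ (basis_ell2 j)), <- HT, <- ip_unit. reflexivity.
Qed.

Theorem matrix_in_S1_iff_nuclear M : matrix_in_S1 M <-> nuclear M.
Proof. split; [apply matrix_in_S1_nuclear | apply nuclear_matrix_in_S1]. Qed.

(** * Nuclear Hankel matrices *)

Definition hankel_nuclear (h : nat -> C) : Prop := nuclear (fun i j => h (i + j)%nat).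

Lemma hankel_ext h g : (forall n, h n = g n) -> hankel_nuclear h -> hankel_nuclear g.
Proof. intros E. apply nuclear_ext. intros; apply E. Qed.

Lemma hankel_plus h g : hankel_nuclear h -> hankel_nuclear g ->
  hankel_nuclear (fun n => (h n + g n)%C).
Proof. apply nuclear_plus. Qed.

Lemma hankel_scal a h : hankel_nuclear h -> hankel_nuclear (fun n => (a * h n)%C).
Proof. apply nuclear_scal. Qed.

Lemma hankel_shift h : hankel_nuclear h -> hankel_nuclear (fun n => h (n + 1)%nat).
Proof.
  intros [c H]. exists c. intros n X HX.
  apply dominated_rowshift, H in HX. rewrite pairing_rowshift in HX.
  rewrite <- (pairing_ext n X X (fun i j => h (i + 1 + j)%nat)); auto.
  intros. do 2 f_equal. lia.
Qed.

Lemma hankel_div h : hankel_nuclear h -> hankel_nuclear (fun n => (RtoC (/ INR (S n)) * h n)%C).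
Proof.
  intros [c H]. exists c. intros n X HX.
  apply (dominated_hilbert 0) in HX; [|intros; lra].
  rewrite <- (pairing_ext n (fun i j : nat =>
         (RtoC (/ (INR (i + 0) + INR (j + 0) + 1)) * X i j)%C) X (fun i j => h (i + j)%nat)).
  - apply H. eapply dominated_weaken; [|exact HX]. intros i _; cbv beta.
    pose proof (pos_INR (i + 0)). rewrite Rmult_1_r, <- Rinv_1. apply Rinv_le_contravar; lra.
  - intros i j _ _. rewrite S_INR, !plus_INR. simpl INR. rewrite !Rplus_0_r. ring.
Qed.

(** The factor z^(i+j) splits into unitary diagonal matrices. *)
Lemma hankel_rotate z h : Cmod z = 1 -> hankel_nuclear h ->
  hankel_nuclear (fun n => (z ^ n * h n)%C).
Proof.
  intros Hz [c H]. exists c. intros n X HX.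
  rewrite <- (pairing_ext n (fun i j => (z ^ i * X i j * z ^ j)%C) X (fun i j => h (i + j)%nat)).
  - apply H. eapply dominated_weaken; [|apply (dominated_diag n X (fun _ => 1) _ _ (fun _ => 1))].
    + intros; simpl; lra.
    + intros; lra.
    + intros i. rewrite Cmod_pow, Hz, pow1. lra.
    + intros i. rewrite Cmod_pow, Hz, pow1. lra.
    + exact HX.
  - intros i j _ _. rewrite Cpow_add_r. ring.
Qed.

(** At z = 0 any unimodular value would do. *)
Definition phase (z : C) : C :=
  if Ceq_dec z 0 then RtoC 1 else (/ z * RtoC (Cmod z))%C.

Lemma phase_spec z : Cmod (phase z) = 1 /\ (phase z * z)%C = RtoC (Cmod z).
Proof.
  unfold phase. destruct (Ceq_dec z 0) as [->|Hz].
  - rewrite Cmod_0. split; [apply Cmod_1 | ring].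
  - pose proof (proj1 (Cmod_gt_0 z) Hz). split.
    + rewrite Cmod_mult, Cmod_inv, Cmod_R, Rabs_pos_eq by (exact Hz || lra). field. lra.
    + field. exact Hz.
Qed.

(** Pairing with a diagonal matrix of phases sums the moduli of the diagonal h(2k). *)
Lemma hankel_summable h : hankel_nuclear h ->
  exists c, forall n, rsum n (fun k => Cmod (h (2 * k)%nat)) <= c.
Proof.
  intros [c H]. exists c. intros n.
  set (u := fun i => phase (h (2 * i)%nat)).
  assert (Hu : forall i, Cmod (u i) = 1 /\ (u i * h (2 * i)%nat)%C = RtoC (Cmod (h (2 * i)%nat)))
    by (intros i; apply phase_spec).
  set (X := fun i j => if Nat.eqb i j then u i else RtoC 0).
  assert (E : forall M, pairing n X M = csum n (fun i => (u i * M i i)%C)).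
  { intros M. apply csum_ext; intros i Hi. rewrite (csum_single n i); auto.
    - unfold X. now rewrite Nat.eqb_refl.
    - intros j _ Hj. unfold X. rewrite (proj2 (Nat.eqb_neq i j)) by auto. ring. }
  specialize (H n X). rewrite E in H.
  rewrite (csum_ext n _ (fun i => RtoC (Cmod (h (2 * i)%nat)))) in H.
  2:{ intros i _. rewrite <- (proj2 (Hu i)). now replace (i + i)%nat with (2 * i)%nat by lia. }
  rewrite csum_RtoC, Cmod_R, Rabs_pos_eq in H.
  2:{ apply rsum_ge0; intros; apply Cmod_ge_0. }
  apply H. intros x y. rewrite E. unfold weighted_sq. rewrite <- rsum_plus.
  eapply Rle_trans; [apply Rmult_le_compat_l; [lra | apply Cmod_csum]|].
  rewrite <- rsum_scal. apply rsum_le; intros i _. rewrite !Cmod_mult, (proj1 (Hu i)).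
  pose proof (pow2_ge_0 (Cmod (x i) - Cmod (y i))). nra.
Qed.

(** On the indices a, b >= k the kernel 2k/(1+a+b) multiplies weights by 2k/(1+2a) <= 1, so each
    factor 1 - 2k/(1+a+b) at most doubles them. *)
Lemma dominated_dilation k N n X p : (forall i, 0 <= p i) -> (forall i, (i < k)%nat -> p i = 0) ->
  dominated n X p ->
  dominated n (fun a b => (RtoC ((1 - 2 * INR k * / (INR a + INR b + 1)) ^ N) * X a b)%C)
    (fun a => 2 ^ N * p a).
Proof.
  intros Hp Hk HX. induction N as [|N IH].
  - simpl. eapply dominated_weaken; [|eapply dominated_ext; [|exact HX]].
    + intros; simpl; lra.
    + intros; simpl; ring.
  - assert (Hp' : forall i, 0 <= 2 ^ N * p i).
    { intros i. apply Rmult_le_pos; auto. apply pow_le; lra. }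
    pose proof (dominated_hilbert 0 _ _ _ Hp' IH) as IH'.
    apply (dominated_scal _ _ _ (RtoC (- (2 * INR k)))) in IH'.
    pose proof (dominated_plus _ _ _ _ _ IH IH') as D.
    eapply dominated_weaken; [|eapply dominated_ext; [|exact D]].
    + intros a _. cbv beta. pose proof (pos_INR k). rewrite Cmod_R, Rabs_Ropp, Rabs_pos_eq by lra.
      rewrite Nat.add_0_r. destruct (Nat.lt_ge_cases a k) as [Ha|Ha].
      * rewrite Hk by auto. lra.
      * apply le_INR in Ha. specialize (Hp' a).
        replace (2 ^ S N * p a) with (2 ^ N * p a + 1 * (2 ^ N * p a)) by (simpl; ring).
        apply Rplus_le_compat_l. rewrite <- Rmult_assoc. apply Rmult_le_compat_r; auto.
        apply Rmult_le_reg_r with (INR a + INR a + 1); [lra|].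
        rewrite Rmult_assoc, Rinv_l by lra. lra.
    + intros a b _ _. cbv beta. rewrite !Nat.add_0_r. simpl pow.
      rewrite !RtoC_opp, !RtoC_mult, !RtoC_minus, !RtoC_mult. ring.
Qed.

Lemma rsum_count K a : rsum K (fun k => if Nat.leb k a then 1 else 0) <= INR a + 1.
Proof.
  revert a. induction K as [|K IH]; intros a; simpl; [pose proof (pos_INR a); lra|].
  destruct (Nat.leb_spec K a).
  - assert (E : forall m, (m <= S a)%nat -> rsum m (fun k => if Nat.leb k a then 1 else 0) = INR m).
    { induction m as [|m IHm]; intros Hm; [reflexivity|]. rewrite S_INR. simpl.
      rewrite IHm by lia. rewrite (proj2 (Nat.leb_le m a)) by lia. reflexivity. }
    rewrite E by lia. apply le_INR in H. lra.
  - specialize (IH a). lra.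
Qed.

(** Put h(n) = (1+n)^(N+1) d_2 psi(n).  Up to the remainder (1+n)^N psi(n+2K), which tends to 0,
      (1+n)^N psi(n) = sum_(k<K) (1+n)^N / (1+n+2k)^(N+1) h(n+2k).
    With a = i+k and b = j+k the coefficient is (1 - 2k/(1+a+b))^N / (1+a+b), so the pairing of the sum
    with X is the pairing of h(a+b) with 1/(1+a+b) times the sum over k of the dilated diagonal shifts
    of X.  The weights are 2^N on a >= k for each k, at most 2^N (a+1) after summation, and at most
    2^N after multiplication by the kernel, uniformly in K. *)
Lemma hankel_lift N psi :
  (forall n, is_lim_seq (fun k => Cmod (psi (n + 2 * k)%nat)) 0) ->
  hankel_nuclear (fun n => (RtoC (INR (S n) ^ S N) * (psi n - psi (n + 2)%nat))%C) ->
  hankel_nuclear (fun n => (RtoC (INR (S n) ^ N) * psi n)%C).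
Proof.
  intros Hlim [c H]. set (h := fun n => (RtoC (INR (S n) ^ S N) * (psi n - psi (n + 2)%nat))%C).
  exists (2 ^ N * c). intros n X HX.
  set (rem := fun K => rsum n (fun i => rsum n (fun j =>
    Cmod (X i j) * INR (S (i + j)) ^ N * Cmod (psi (i + j + 2 * K)%nat)))).
  assert (Hrem : is_lim_seq rem 0).
  { assert (L : forall m (f : nat -> nat -> R), (forall i, is_lim_seq (f i) 0) ->
      is_lim_seq (fun K => rsum m (fun i => f i K)) 0).
    { intros m f Hf. induction m as [|m IH]; simpl; [apply is_lim_seq_const|].
      replace (Finite 0) with (Finite (0 + 0)) by (f_equal; ring).
      now apply is_lim_seq_plus'. }
    unfold rem. apply (L n (fun i K => rsum n (fun j => _ ))). intros i.
    apply (L n (fun j K => _)). intros j.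
    rewrite <- (Rmult_0_r (Cmod (X i j) * INR (S (i + j)) ^ N)).
    apply (is_lim_seq_scal_l _ _ (Finite 0)), Hlim. }
  assert (Hbound : forall K, Cmod (pairing n X (fun i j => (RtoC (INR (S (i + j)) ^ N) * psi (i + j)%nat)%C))
     <= rem K + 2 ^ N * c).
  { intros K.
    set (G := fun k a b => (RtoC ((1 - 2 * INR k * / (INR a + INR b + 1)) ^ N * / (INR a + INR b + 1)) * h (a + b)%nat)%C).
    rewrite (pairing_ext n X X _ (fun i j => (RtoC (INR (S (i + j)) ^ N) * psi (i + j + 2 * K)%nat
        + csum K (fun k => G k (i + k)%nat (j + k)%nat))%C)).
    2:{ intros i j _ _. f_equal.
      assert (E : forall s, psi s = (psi (s + 2 * K)%nat + csum K (fun k => psi (s + 2 * k)%nat - psi (s + 2 * k + 2)%nat))%C).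
      { intros s. clear. induction K as [|K IH]; cbn [csum].
        - rewrite Nat.mul_0_r, Nat.add_0_r. ring.
        - rewrite IH at 1. replace (s + 2 * S K)%nat with (s + 2 * K + 2)%nat by lia. ring. }
      rewrite (E (i + j)%nat) at 1. rewrite Cmult_plus_distr_l. f_equal.
      rewrite <- csum_scal. apply csum_ext; intros k _. unfold G, h.
      rewrite Cmult_assoc, <- RtoC_mult. replace (i + k + (j + k))%nat with (i + j + 2 * k)%nat by lia.
      f_equal. f_equal. rewrite S_INR, S_INR, !plus_INR, mult_INR. simpl (INR 2).
      pose proof (pos_INR i); pose proof (pos_INR j); pose proof (pos_INR k).
      set (d := INR i + INR j + (1 + 1) * INR k + 1).
      replace (INR i + INR k + (INR j + INR k) + 1) with d by (unfold d; ring).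
      assert (0 < d) by (unfold d; lra).
      replace (INR i + INR j + 1) with ((1 - 2 * INR k * / d) * d) by (unfold d in *; field; lra).
      rewrite Rpow_mult_distr. simpl pow. field. lra. }
    rewrite pairing_plus. eapply Rle_trans; [apply Cmod_triangle|]. apply Rplus_le_compat.
    - unfold pairing, rem. eapply Rle_trans; [apply Cmod_csum|]. apply rsum_le; intros i _.
      eapply Rle_trans; [apply Cmod_csum|]. apply rsum_le; intros j _.
      rewrite !Cmod_mult, Cmod_R, Rabs_pos_eq; [lra|]. apply pow_le, pos_INR.
    - (* Padding X by zeros to size n+K-k and then shifting it by k brings the terms for all k to the
         common size n+K. *)
      set (Xe := fun i j => if (Nat.ltb i n && Nat.ltb j n)%bool then X i j else RtoC 0).
      set (Y := fun a b => (RtoC (/ (INR (a + 0) + INR (b + 0) + 1)) * csum K (fun k =>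
        (RtoC ((1 - 2 * INR k * / (INR a + INR b + 1)) ^ N) * shifted k Xe a b)))%C).
      assert (HY : dominated (n + K) Y (fun _ => 2 ^ N)).
      { eapply dominated_weaken; [|apply (dominated_hilbert 0); [|apply (dominated_csum (n + K) K
          (fun k a b => (RtoC ((1 - 2 * INR k * / (INR a + INR b + 1)) ^ N) * shifted k Xe a b)%C)
          (fun k a => 2 ^ N * (if Nat.leb k a then 1 else 0)))]].
        - intros a _. cbv beta. rewrite rsum_scal, Nat.add_0_r.
          pose proof (rsum_count K a). pose proof (pos_INR a).
          assert (0 < 2 ^ N) by (apply pow_lt; lra).
          apply Rmult_le_reg_l with (INR a + INR a + 1); [lra|].
          rewrite <- Rmult_assoc, Rinv_r, Rmult_1_l by lra. nra.
        - intros a. apply rsum_ge0; intros k _. apply Rmult_le_pos; [apply pow_le; lra|].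
          destruct Nat.leb; lra.
        - intros k Hk. apply dominated_dilation.
          + intros a; destruct Nat.leb; lra.
          + intros a Ha. now rewrite (proj2 (Nat.leb_gt k a)) by lia.
          + replace (n + K)%nat with ((n + K - k) + k)%nat by lia.
            apply dominated_shifted. apply dominated_widen; auto; [lia|]. intros; lra. }
      pose proof (pow_lt 2 N ltac:(lra)) as H2.
      pose proof (dominated_pairing _ _ _ (fun a b => h (a + b)%nat) c H2 HY H) as HP.
      rewrite pairing_csum.
      erewrite csum_ext with (g := fun k => pairing (n + K) (shifted k Xe) (G k)).
      2:{ intros k Hk. replace (n + K)%nat with ((n + K - k) + k)%nat by lia.
          rewrite pairing_shifted. unfold Xe. rewrite pairing_widen by lia. reflexivity. }
      rewrite <- (csum_ext K (fun k => pairing (n + K) (fun a b => h (a + b)%nat) (fun a b => 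
         (RtoC ((1 - 2 * INR k * / (INR a + INR b + 1)) ^ N * / (INR a + INR b + 1)) * shifted k Xe a b)%C))).
      2:{ intros k _. apply csum_ext; intros a _; apply csum_ext; intros b _. unfold G. ring. }
      rewrite <- pairing_csum, pairing_swap.
      rewrite (pairing_ext _ _ Y _ (fun a b => h (a + b)%nat)); [exact HP|].
      intros a b _ _. f_equal. unfold Y. rewrite !Nat.add_0_r, <- csum_scal.
      apply csum_ext; intros k _. rewrite RtoC_mult. ring. }
  assert (Hl : is_lim_seq (fun K => rem K + 2 ^ N * c) (0 + 2 ^ N * c))
    by (apply is_lim_seq_plus'; [exact Hrem | apply is_lim_seq_const]).
  pose proof (is_lim_seq_le _ _ _ _ Hbound (is_lim_seq_const _) Hl) as HP.
  simpl in HP. rewrite Rplus_0_l in HP. exact HP.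
Qed.

(** The matrix is the entrywise product of the kernels 1/(1+i+j) and 1/(3+i+j).  Multiplying X by both
    leaves the weight 1/((1+2i)(3+2i)), whose sum telescopes to at most 1/2; testing at the constant
    vector 1 then bounds the pairing. *)
Lemma hankel_reciprocal_product : hankel_nuclear (fun n => RtoC (/ (INR n + 1) * / (INR n + 3))).
Proof.
  exists (1 / 2). intros n X HX.
  apply (dominated_hilbert 0) in HX; [|intros; lra].
  apply (dominated_hilbert 1) in HX.
  2:{ intros i. pose proof (pos_INR (i + 0)). rewrite Rmult_1_r. left; apply Rinv_0_lt_compat; lra. }
  specialize (HX (fun _ => RtoC 1) (fun _ => RtoC 1)). unfold weighted_sq in HX.
  assert (T : forall m, rsum m (fun i => / (INR (i + 1) + INR (i + 1) + 1) *
        (/ (INR (i + 0) + INR (i + 0) + 1) * 1) * Cmod 1 ^ 2) = (1 - / (2 * INR m + 1)) / 2).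
  { induction m as [|m IH]; [simpl; field|]. cbn [rsum]. rewrite IH, Cmod_1, S_INR, !plus_INR. simpl INR.
    pose proof (pos_INR m). field. split; lra. }
  rewrite !T in HX.
  match type of HX with 2 * Cmod ?u <= _ => match goal with |- Cmod ?v <= _ => replace v with u end end.
  - assert (0 < / (2 * INR n + 1)) by (apply Rinv_0_lt_compat; pose proof (pos_INR n); lra). lra.
  - apply pairing_ext. intros i j _ _. rewrite !plus_INR. simpl INR.
    replace (INR i + 1 + (INR j + 1) + 1) with (INR i + INR j + 3) by ring.
    rewrite !Rplus_0_r, RtoC_mult. ring.
Qed.

(** * Weighted Hankel matrices and differences *)

Definition weighted (M : nat) (psi : nat -> C) : Prop :=
  hankel_nuclear (fun n => (RtoC (INR (S n) ^ M) * psi n)%C).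

Lemma weighted_plus M f g : weighted M f -> weighted M g -> weighted M (fun n => (f n + g n)%C).
Proof.
  intros Hf Hg. eapply hankel_ext; [|exact (hankel_plus _ _ Hf Hg)]. intros; simpl; ring.
Qed.

Lemma weighted_scal M a f : weighted M f -> weighted M (fun n => (a * f n)%C).
Proof.
  intros Hf. eapply hankel_ext; [|exact (hankel_scal a _ Hf)]. intros; simpl; ring.
Qed.

(** Shifting (1+n)^M f(n) would produce (2+n)^M f(n+1).  Multiplying beforehand by
    (n/(n+1))^M = (1 - 1/(n+1))^M, which division by n+1 makes harmless, corrects the weight. *)
Lemma weighted_shift M f : weighted M f -> weighted M (fun n => f (n + 1)%nat).
Proof.
  intros Hf.
  assert (H : forall k h, hankel_nuclear h ->
    hankel_nuclear (fun n => (RtoC ((INR n / INR (S n)) ^ k) * h n)%C)).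
  { intros k; induction k as [|k IH]; intros h Hh.
    - eapply hankel_ext; [|exact Hh]. intros; simpl; ring.
    - apply IH in Hh. pose proof (hankel_plus _ _ Hh (hankel_scal (RtoC (-1)) _ (hankel_div _ Hh))) as H.
      eapply hankel_ext; [|exact H]. intros n. cbv beta.
      assert (E : INR n / INR (S n) = 1 + -1 * / INR (S n))
        by (rewrite S_INR; pose proof (pos_INR n); field; lra).
      rewrite E. cbn [pow]. rewrite !RtoC_mult, RtoC_plus, RtoC_mult. ring. }
  eapply hankel_ext; [|exact (hankel_shift _ (H M _ Hf))]. intros n. cbv beta.
  rewrite Cmult_assoc, <- RtoC_mult, <- Rpow_mult_distr, Nat.add_1_r.
  replace (INR (S n) / INR (S (S n)) * INR (S (S n))) with (INR (S n)); [reflexivity|].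
  rewrite (S_INR (S n)). pose proof (pos_INR (S n)). field. lra.
Qed.

Lemma weighted_lower M f : weighted (S M) f -> weighted M f.
Proof.
  intros H. eapply hankel_ext; [|exact (hankel_div _ H)]. intros n. cbv beta.
  rewrite Cmult_assoc, <- RtoC_mult. replace (/ INR (S n) * INR (S n) ^ S M) with (INR (S n) ^ M);
    [reflexivity|]. cbn [pow]. field. apply not_0_INR; lia.
Qed.

Lemma weighted_unweight M f : weighted M f -> hankel_nuclear f.
Proof.
  induction M as [|M IH]; intros H.
  - eapply hankel_ext; [|exact H]. intros; simpl; ring.
  - apply IH, weighted_lower, H.
Qed.

Lemma weighted_diff M f j : weighted M f -> weighted M (diff j f).
Proof.
  intros H. assert (Hj : weighted M (fun n => f (n + j)%nat)).
  { induction j as [|j IH].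
    - eapply hankel_ext; [|exact H]. intros n; cbv beta. now rewrite Nat.add_0_r.
    - eapply hankel_ext; [|exact (weighted_shift _ _ IH)]. intros n; cbv beta.
      now replace (n + 1 + j)%nat with (n + S j)%nat by lia. }
  eapply hankel_ext; [|exact (weighted_plus _ _ _ H (weighted_scal _ (RtoC (-1)) _ Hj))].
  intros n. cbv beta. unfold diff. ring.
Qed.

Lemma weighted_diff_iter M f j m : weighted M f -> weighted M (diff_iter j m f).
Proof. intros H. induction m as [|m IH]; [exact H | apply (weighted_diff M _ j IH)]. Qed.

Lemma diff_iter_succ j m f : diff_iter j (S m) f = diff_iter j m (diff j f).
Proof. induction m as [|m IH]; [reflexivity|]. simpl. f_equal. exact IH. Qed.

Lemma diff_iter_double_step m f :
  diff_iter 1 m (diff 2 f) = fun n => (diff_iter 1 (S m) f n + diff_iter 1 (S m) f (n + 1)%nat)%C.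
Proof.
  induction m as [|m IH]; extensionality n.
  - simpl. unfold diff. replace (n + 1 + 1)%nat with (n + 2)%nat by lia. ring.
  - change (diff_iter 1 (S m) (diff 2 f)) with (diff 1 (diff_iter 1 m (diff 2 f))). rewrite IH.
    change (diff_iter 1 (S (S m)) f) with (diff 1 (diff_iter 1 (S m) f)).
    set (g := diff_iter 1 (S m) f). unfold diff. ring.
Qed.

(** Because d_2 = d_1 (1 + shift), and shifts are harmless. *)
Lemma weighted_diff1_diff2 M m f : weighted M (diff_iter 1 m f) -> weighted M (diff_iter 2 m f).
Proof.
  revert f; induction m as [|m IH]; intros f H; [exact H|].
  rewrite diff_iter_succ. apply IH. rewrite diff_iter_double_step.
  apply weighted_plus; [exact H | apply (weighted_shift _ _ H)].
Qed.

(** * Decay of bounded differences *)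

Lemma hankel_summable_steps2 h n : hankel_nuclear h ->
  exists c, forall K, rsum K (fun k => Cmod (h (n + 2 * k)%nat)) <= c.
Proof.
  intros H. assert (Hn : hankel_nuclear (fun m => h (m + n)%nat)).
  { induction n as [|n IH].
    - eapply hankel_ext; [|exact H]. intros; now rewrite Nat.add_0_r.
    - eapply hankel_ext; [|exact (hankel_shift _ IH)]. intros m; cbv beta.
      now replace (m + 1 + n)%nat with (m + S n)%nat by lia. }
  destruct (hankel_summable _ Hn) as [c Hc]. exists c. intros K.
  rewrite <- (rsum_ext K (fun k => Cmod (h (2 * k + n)%nat))); auto.
  intros k _. now rewrite Nat.add_comm.
Qed.

Lemma hankel_summable_steps1 h n : hankel_nuclear h ->
  exists c, forall K, rsum K (fun k => Cmod (h (n + k)%nat)) <= c.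
Proof.
  intros H. destruct (hankel_summable_steps2 h n H) as [c Hc], (hankel_summable_steps2 h (n + 1) H) as [c' Hc'].
  exists (c + c'). intros K.
  apply Rle_trans with (rsum (2 * K) (fun k => Cmod (h (n + k)%nat))).
  { apply rsum_mono; [lia | intros; apply Cmod_ge_0]. }
  specialize (Hc K). specialize (Hc' K).
  assert (E : rsum (2 * K) (fun k => Cmod (h (n + k)%nat)) =
    rsum K (fun k => Cmod (h (n + 2 * k)%nat)) + rsum K (fun k => Cmod (h (n + 1 + 2 * k)%nat))).
  { clear. induction K as [|K IH]; [simpl; ring|].
    replace (2 * S K)%nat with (S (S (2 * K))) by lia. cbn [rsum]. rewrite IH.
    replace (n + S (2 * K))%nat with (n + 1 + 2 * K)%nat by lia. ring. }
  lra.
Qed.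

(** The sequence has bounded variation, hence is nearly constant from some index on; if this constant
    were not small, the partial sums would grow linearly. *)
Lemma bounded_sums_vanish (a : nat -> C) c M :
  (forall n, rsum n (fun k => Cmod (a k - a (S k))%C) <= c) ->
  (forall n, Cmod (csum n a) <= M) ->
  is_lim_seq (fun k => Cmod (a k)) 0.
Proof.
  intros Hc HM. set (s := fun n => rsum n (fun k => Cmod (a k - a (S k))%C)).
  assert (Hs : forall n, s n <= s (S n)) by (intros n; unfold s; simpl; pose proof (Cmod_ge_0 (a n - a (S n))%C); lra).
  destruct (ex_finite_lim_seq_incr s c Hs Hc) as [l Hl].
  assert (Hle : forall n, s n <= l) by (intros n; apply (is_lim_seq_incr_compare s l Hl Hs)).
  assert (Hd : forall k d, Cmod (a k - a (k + d)%nat)%C <= s (k + d)%nat - s k).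
  { intros k d; induction d as [|d IH].
    - rewrite Nat.add_0_r. replace (a k - a k)%C with (RtoC 0) by ring. rewrite Cmod_0. lra.
    - replace (k + S d)%nat with (S (k + d)) by lia.
      replace (a k - a (S (k + d)))%C with ((a k - a (k + d)%nat) + (a (k + d)%nat - a (S (k + d))))%C by ring.
      eapply Rle_trans; [apply Cmod_triangle|]. unfold s in *. simpl. lra. }
  apply is_lim_seq_spec. intros eps. 
  pose proof (proj2 (is_lim_seq_spec s l) Hl) as Hsp.
  destruct eps as [eps Heps]. assert (He : 0 < eps / 2) by lra.
  destruct (Hsp (mkposreal _ He)) as [k0 Hk0]. exists k0. intros k Hk. simpl in Hk0 |- *.
  rewrite Rminus_0_r, Rabs_pos_eq by apply Cmod_ge_0.
  specialize (Hk0 k Hk). apply Rabs_def2 in Hk0.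
  (* Averaging over a window of length L that starts at k: the sum of the a_(k+i) is at most 2M, and
     a_k differs from each of its terms by at most l - s_k. *)
  assert (HL : forall L, INR L * Cmod (a k) <= 2 * M + INR L * (l - s k)).
  { intros L.
    assert (E : (RtoC (INR L) * a k = csum L (fun i => a (i + k)%nat) + csum L (fun i => a k - a (k + i)%nat))%C).
    { clear. induction L as [|L IH]; [simpl; ring|]. rewrite S_INR, RtoC_plus. simpl.
      rewrite (Nat.add_comm L k). 
      replace ((RtoC (INR L) + 1) * a k)%C with (RtoC (INR L) * a k + a k)%C by ring. rewrite IH. ring. }
    rewrite <- (Rabs_pos_eq (INR L)) at 1 by apply pos_INR. rewrite <- Cmod_R, <- Cmod_mult, E.
    eapply Rle_trans; [apply Cmod_triangle|]. apply Rplus_le_compat.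
    - replace (csum L (fun i => a (i + k)%nat)) with (csum (L + k) a - csum k a)%C by (rewrite csum_add; ring).
      eapply Rle_trans; [apply Cmod_triangle|]. rewrite Cmod_opp. pose proof (HM (L + k)%nat). pose proof (HM k). lra.
    - eapply Rle_trans; [apply Cmod_csum|]. clear - Hle Hd.
      induction L as [|L IH]; [simpl; lra|]. rewrite S_INR. cbn [rsum]. 
      specialize (Hd k L). specialize (Hle (k + L)%nat). lra. }
  destruct (Rlt_le_dec (Cmod (a k)) eps) as [|Hge]; auto. exfalso.
  assert (HM0 : 0 <= M) by (eapply Rle_trans; [apply Cmod_ge_0 | apply (HM 0%nat)]).
  destruct (INR_unbounded (2 * M / (eps / 2 - (l - s k)))) as [L HLL].
  specialize (HL L). assert (0 < eps / 2 - (l - s k)) by lra.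
  apply (Rmult_lt_compat_r (eps / 2 - (l - s k))) in HLL; [|lra].
  replace (2 * M / (eps / 2 - (l - s k)) * (eps / 2 - (l - s k))) with (2 * M) in HLL by (field; lra).
  pose proof (pos_INR L). nra.
Qed.

Lemma csum_diff j f n K : csum K (fun k => diff j f (n + j * k)%nat) = (f n - f (n + j * K)%nat)%C.
Proof.
  induction K as [|K IH]; cbn [csum].
  - rewrite Nat.mul_0_r, Nat.add_0_r. ring.
  - rewrite IH. unfold diff. replace (n + j * K + j)%nat with (n + j * S K)%nat by lia. ring.
Qed.

Lemma csum_diff_bounded j f n : ell_infty f -> exists M, forall K,
  Cmod (csum K (fun k => diff j f (n + j * k)%nat)) <= M.
Proof.
  intros [M HM]. exists (M + M). intros K. rewrite csum_diff.
  eapply Rle_trans; [apply Cmod_triangle|]. rewrite Cmod_opp. apply Rplus_le_compat; auto.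
Qed.

(** The partial sums of d_j f along steps of length j telescope, hence are bounded by boundedness
    of f. *)
Lemma diff_vanishing j f n : j = 1%nat \/ j = 2%nat -> ell_infty f -> hankel_nuclear (diff j (diff j f)) ->
  is_lim_seq (fun k => Cmod (diff j f (n + j * k)%nat)) 0.
Proof.
  intros Hj Hf H. destruct (csum_diff_bounded j f n Hf) as [M HM].
  assert (Hc : exists c, forall K, rsum K (fun k => Cmod (diff j (diff j f) (n + j * k)%nat)) <= c).
  { destruct Hj as [-> | ->].
    - destruct (hankel_summable_steps1 _ n H) as [c Hc]. exists c. intros K. 
      rewrite <- (rsum_ext K (fun k => Cmod (diff 1 (diff 1 f) (n + k)%nat))); auto.
      intros k _. now rewrite Nat.mul_1_l.
    - exact (hankel_summable_steps2 _ n H). }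
  destruct Hc as [c Hc].
  apply bounded_sums_vanish with (c := c) (M := M) (a := fun k => diff j f (n + j * k)%nat); auto.
  intros K. rewrite <- (rsum_ext K (fun k => Cmod (diff j (diff j f) (n + j * k)%nat))); auto.
  intros k _. unfold diff at 1. now replace (n + j * k + j)%nat with (n + j * S k)%nat by lia.
Qed.

Lemma ell_infty_diff_iter j m f : ell_infty f -> ell_infty (diff_iter j m f).
Proof.
  intros H. induction m as [|m [M HM]]; [exact H|]. exists (M + M). intros n.
  simpl. unfold diff at 1. eapply Rle_trans; [apply Cmod_triangle|]. rewrite Cmod_opp.
  apply Rplus_le_compat; apply HM.
Qed.

Lemma weighted_lift M psi : (forall n, is_lim_seq (fun k => Cmod (psi (n + 2 * k)%nat)) 0) ->
  weighted (S M) (diff 2 psi) -> weighted M psi.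
Proof. intros Hl H. apply hankel_lift; auto. Qed.

Lemma weighted_descent2 M m f : ell_infty f ->
  weighted (S M) (diff_iter 2 (S (S m)) f) -> weighted M (diff_iter 2 (S m) f).
Proof.
  intros Hf H. apply weighted_lift; [|exact H]. intros n.
  apply (diff_vanishing 2 (diff_iter 2 m f)); auto.
  - now apply ell_infty_diff_iter.
  - exact (weighted_unweight _ _ H).
Qed.

(** The differences of psi = d_1^(m+1) f along steps of length 2 are sums of two consecutive
    differences of length 1, so the lifting argument for d_2 applies here too. *)
Lemma weighted_descent1 M m f : ell_infty f ->
  weighted (S M) (diff_iter 1 (S (S m)) f) -> weighted M (diff_iter 1 (S m) f).
Proof.
  intros Hf H. apply weighted_lift.
  - intros n. pose proof (diff_vanishing 1 (diff_iter 1 m f) n (or_introl eq_refl)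
      (ell_infty_diff_iter _ _ _ Hf) (weighted_unweight _ _ H)) as L.
    apply (is_lim_seq_subseq _ _ (fun k => (2 * k)%nat)) in L.
    + eapply is_lim_seq_ext; [|exact L]. intros k; cbv beta. now rewrite Nat.mul_1_l.
    + apply eventually_subseq. intros; lia.
  - change (diff_iter 1 (S (S m)) f) with (diff 1 (diff_iter 1 (S m) f)) in H.
    eapply hankel_ext; [|exact (weighted_plus _ _ _ H (weighted_shift _ _ H))].
    intros n. cbv beta. f_equal. unfold diff. replace (n + 1 + 1)%nat with (n + 2)%nat by lia. ring.
Qed.

(** Each dyadic block contributes at least 1/5. *)
Lemma harmonic_unbounded c : exists n, c < rsum n (fun k => / (INR (2 * k) + 3)).
Proof.
  assert (H : forall m, INR m / 5 <= rsum (2 ^ m) (fun k => / (INR (2 * k) + 3))).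
  { induction m as [|m IH].
    - simpl. unfold Rdiv. rewrite Rmult_0_l, Rplus_0_l. left. apply Rinv_0_lt_compat. lra.
    - replace (2 ^ S m)%nat with (2 ^ m + 2 ^ m)%nat by (simpl; lia).
      rewrite rsum_add, S_INR.
      assert (Hp : (1 <= 2 ^ m)%nat) by (pose proof (Nat.pow_nonzero 2 m); lia).
      set (p := (2 ^ m)%nat) in *.
      assert (B : rsum p (fun _ => / (5 * INR p)) <= rsum p (fun i => / (INR (2 * (i + p)) + 3))).
      { apply rsum_le; intros i Hi. apply le_INR in Hp. simpl in Hp.
        apply Rinv_le_contravar.
        - pose proof (pos_INR (2 * (i + p))). lra.
        - assert (Hi' : (S i <= p)%nat) by lia. apply le_INR in Hi'. rewrite S_INR in Hi'.
          rewrite mult_INR, plus_INR. simpl INR. lra. }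
      assert (E : rsum p (fun _ => / (5 * INR p)) = / 5).
      { assert (E : forall q a, rsum q (fun _ => a) = INR q * a).
        { intros q a; induction q as [|q IHq]; [simpl; ring|]. rewrite S_INR. cbn [rsum]. rewrite IHq. ring. }
        rewrite E. apply le_INR in Hp. simpl in Hp. field. lra. }
      lra. }
  destruct (INR_unbounded (5 * c)) as [m Hm]. exists (2 ^ m)%nat. specialize (H m). lra.
Qed.

Lemma not_hankel_nuclear h : (forall n, / (INR n + 3) <= Cmod (h n)) -> ~ hankel_nuclear h.
Proof.
  intros Hh H. destruct (hankel_summable h H) as [c Hc], (harmonic_unbounded c) as [n Hn].
  specialize (Hc n).
  assert (rsum n (fun k => / (INR (2 * k) + 3)) <= rsum n (fun k => Cmod (h (2 * k)%nat)))
    by (apply rsum_le; auto). lra.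
Qed.

(** * Three sequences *)

(** The factor i^n turns d_2 into a sum: d_2 (i^n r(n)) = i^n (r(n) + r(n+2)). *)
Definition oscillating (N n : nat) : C := (Ci ^ n * RtoC (/ INR (S n) ^ N * / (INR n + 3)))%C.

Definition alternating (n : nat) : C := (RtoC (-1) ^ n)%C.

Definition reciprocal (n : nat) : C := RtoC (/ INR (S n)).

Lemma inv_le_1 x : 1 <= x -> / x <= 1.
Proof. intros H. rewrite <- Rinv_1. apply Rinv_le_contravar; lra. Qed.

Lemma INR_S_ge1 n : 1 <= INR (S n).
Proof. rewrite S_INR. pose proof (pos_INR n). lra. Qed.

Lemma oscillating_bounded N : ell_infty (oscillating N).
Proof.
  exists 1. intros n. unfold oscillating.
  pose proof (pos_INR n). pose proof (INR_S_ge1 n).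
  pose proof (pow_R1_Rle _ N (INR_S_ge1 n)).
  rewrite Cmod_mult, Cmod_pow, Cmod_Ci, pow1, Rmult_1_l, Cmod_R.
  assert (0 < / INR (S n) ^ N) by (apply Rinv_0_lt_compat; lra).
  assert (0 < / (INR n + 3)) by (apply Rinv_0_lt_compat; lra).
  rewrite Rabs_pos_eq by nra.
  assert (/ (INR n + 3) <= 1) by (apply inv_le_1; lra).
  assert (/ INR (S n) ^ N <= 1) by (now apply inv_le_1). nra.
Qed.

Lemma oscillating_weighted M : weighted M (oscillating (S M)).
Proof.
  eapply hankel_ext; [|exact (hankel_rotate Ci _ Cmod_Ci hankel_reciprocal_product)].
  intros n. cbv beta. unfold oscillating.
  replace (RtoC (INR (S n) ^ M) * (Ci ^ n * RtoC (/ INR (S n) ^ S M * / (INR n + 3))))%C with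
    (Ci ^ n * (RtoC (INR (S n) ^ M) * RtoC (/ INR (S n) ^ S M * / (INR n + 3))))%C by ring.
  rewrite <- RtoC_mult, <- S_INR.
  replace (INR (S n) ^ M * (/ INR (S n) ^ S M * / (INR n + 3)))
    with (/ INR (S n) * / (INR n + 3)); [reflexivity|].
  pose proof (INR_S_ge1 n). pose proof (pos_INR n). cbn [pow]. field.
  repeat split; try lra. apply pow_nonzero; lra.
Qed.

Lemma oscillating_diff N m : exists r : nat -> R,
  (forall n, diff_iter 2 m (oscillating N) n = (Ci ^ n * RtoC (r n))%C) /\
  (forall n, / INR (S n) ^ N * / (INR n + 3) <= r n).
Proof.
  induction m as [|m [r [Hr Hle]]].
  - exists (fun n => / INR (S n) ^ N * / (INR n + 3)). split; [reflexivity | intros; lra].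
  - exists (fun n => r n + r (n + 2)%nat). split; intros n.
    + simpl. unfold diff at 1. change (Nat.iter m (diff 2)) with (diff_iter 2 m). rewrite !Hr.
      rewrite Cpow_add_r, RtoC_plus. replace (Ci ^ 2)%C with (RtoC (-1)); [ring|].
      simpl. apply injective_projections; simpl; ring.
    + pose proof (Hle n). pose proof (Hle (n + 2)%nat).
      assert (0 < / INR (S (n + 2)) ^ N) by (apply Rinv_0_lt_compat, pow_lt; pose proof (INR_S_ge1 (n + 2)); lra).
      assert (0 < / (INR (n + 2) + 3)) by (apply Rinv_0_lt_compat; pose proof (pos_INR (n + 2)); lra).
      nra.
Qed.

Lemma oscillating_not_weighted N m : ~ weighted N (diff_iter 2 m (oscillating N)).
Proof.
  apply not_hankel_nuclear. intros n. destruct (oscillating_diff N m) as [r [Hr Hle]].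
  rewrite Hr, !Cmod_mult, Cmod_pow, Cmod_Ci, pow1, Rmult_1_l, !Cmod_R.
  pose proof (INR_S_ge1 n) as H1. assert (Hp : 0 < INR (S n) ^ N) by (apply pow_lt; lra).
  specialize (Hle n). rewrite (Rabs_pos_eq (_ ^ _)) by lra.
  eapply Rle_trans; [|apply Rmult_le_compat_l; [lra | apply Rle_abs]].
  apply (Rmult_le_compat_l _ _ _ (Rlt_le _ _ Hp)) in Hle. eapply Rle_trans; [|exact Hle].
  rewrite <- Rmult_assoc, Rinv_r by lra. lra.
Qed.

Lemma alternating_bounded : ell_infty alternating.
Proof.
  exists 1. intros n. unfold alternating. rewrite Cmod_pow, Cmod_R, (Rabs_left (-1)) by lra; replace (- -1) with 1 by ring; rewrite pow1. lra.
Qed.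

Lemma weighted_0 M f : (forall n, f n = RtoC 0) -> weighted M f.
Proof.
  intros H. exists 0. intros n X _. unfold pairing. rewrite csum_0; [rewrite Cmod_0; lra|].
  intros; apply csum_0; intros. rewrite H. ring.
Qed.

Lemma alternating_diff2 m n : diff_iter 2 (S m) alternating n = RtoC 0.
Proof.
  revert n; induction m as [|m IH]; intros n.
  - simpl. unfold diff, alternating. rewrite Cpow_add_r. simpl. ring.
  - change (diff_iter 2 (S (S m)) alternating) with (diff 2 (diff_iter 2 (S m) alternating)).
    unfold diff. rewrite !IH. ring.
Qed.

Lemma alternating_diff1 m n : diff_iter 1 m alternating n = (RtoC (2 ^ m) * alternating n)%C.
Proof.
  revert n; induction m as [|m IH]; intros n.
  - simpl. ring.
  - change (diff_iter 1 (S m) alternating) with (diff 1 (diff_iter 1 m alternating)).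
    unfold diff. rewrite !IH. unfold alternating. rewrite Cpow_add_r. simpl pow. rewrite RtoC_mult. simpl. ring.
Qed.

Lemma alternating_not_weighted M m : ~ weighted M (diff_iter 1 m alternating).
Proof.
  apply not_hankel_nuclear. intros n. rewrite alternating_diff1, !Cmod_mult, !Cmod_R.
  unfold alternating. rewrite Cmod_pow, Cmod_R, (Rabs_left (-1)) by lra; replace (- -1) with 1 by ring; rewrite pow1.
  pose proof (pow_R1_Rle _ M (INR_S_ge1 n)). pose proof (pow_R1_Rle 2 m ltac:(lra)).
  rewrite !Rabs_pos_eq by lra. pose proof (pos_INR n).
  assert (/ (INR n + 3) <= 1) by (apply inv_le_1; lra). nra.
Qed.

Lemma reciprocal_bounded : ell_infty reciprocal.
Proof.
  exists 1. intros n. unfold reciprocal. pose proof (INR_S_ge1 n). rewrite Cmod_R, Rabs_pos_eq.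
  - now apply inv_le_1.
  - left. apply Rinv_0_lt_compat. lra.
Qed.

Lemma reciprocal_diff n : diff 2 reciprocal n = (RtoC 2 * RtoC (/ (INR n + 1) * / (INR n + 3)))%C.
Proof.
  unfold diff, reciprocal. rewrite <- RtoC_mult, <- RtoC_minus. f_equal.
  rewrite !S_INR, plus_INR. simpl INR. pose proof (pos_INR n). field. lra.
Qed.

(** Leibniz rule for d_2^(m+1) applied to the constant sequence (n+1) * 1/(n+1). *)
Lemma reciprocal_diff_iter m n :
  (RtoC (INR (S n)) * diff_iter 2 (S m) reciprocal n =
   RtoC (2 * INR (S m)) * diff_iter 2 m reciprocal (n + 2)%nat)%C.
Proof.
  revert n; induction m as [|m IH]; intros n.
  - change (diff_iter 2 1 reciprocal) with (diff 2 reciprocal). rewrite reciprocal_diff.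
    simpl diff_iter. unfold reciprocal. rewrite <- !RtoC_mult. f_equal.
    rewrite !S_INR, plus_INR. simpl INR. pose proof (pos_INR n). field. lra.
  - pose proof (IH n) as E1. pose proof (IH (n + 2)%nat) as E2.
    set (f := diff_iter 2 (S m) reciprocal) in *.
    change (diff_iter 2 (S (S m)) reciprocal) with (diff 2 f). unfold diff.
    assert (E3 : f (n + 2)%nat = (diff_iter 2 m reciprocal (n + 2)%nat - diff_iter 2 m reciprocal (n + 2 + 2)%nat)%C)
      by reflexivity.
    assert (Es : RtoC (INR (S n)) = (RtoC (INR (S (n + 2))) - 2)%C)
      by (rewrite <- RtoC_minus; f_equal; rewrite !S_INR, plus_INR; simpl INR; ring).
    replace (RtoC (INR (S n)) * (f n - f (n + 2)%nat))%C with
      (RtoC (INR (S n)) * f n - RtoC (INR (S (n + 2))) * f (n + 2)%nat + 2 * f (n + 2)%nat)%C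
      by (rewrite Es; ring).
    rewrite E1, E2, E3, (S_INR (S m)), Rmult_plus_distr_l, RtoC_plus, Rmult_1_r. ring.
Qed.

(** By [reciprocal_diff_iter] one more power of n+1 turns a difference into a multiple of the shifted
    difference of lower order, down to the product 1/((n+1)(n+3)). *)
Lemma reciprocal_weighted m : weighted m (diff_iter 2 (S m) reciprocal).
Proof.
  induction m as [|m IH].
  - eapply hankel_ext; [|exact (hankel_scal 2 _ hankel_reciprocal_product)]. intros n. cbv beta.
    change (diff_iter 2 1 reciprocal) with (diff 2 reciprocal). rewrite reciprocal_diff. simpl. ring.
  - pose proof (weighted_scal _ (RtoC (2 * INR (S (S m)))) _ (weighted_shift _ _ (weighted_shift _ _ IH))) as H.
    eapply hankel_ext; [|exact H]. intros n. cbv beta.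
    replace (n + 1 + 1)%nat with (n + 2)%nat by lia.
    rewrite <- reciprocal_diff_iter. cbn [pow]. rewrite RtoC_mult. ring.
Qed.

Lemma reciprocal_not_weighted M : ~ weighted (S M) (diff 2 reciprocal).
Proof.
  apply not_hankel_nuclear. intros n. rewrite reciprocal_diff, !Cmod_mult, !Cmod_R.
  pose proof (pow_R1_Rle _ M (INR_S_ge1 n)) as Hp. pose proof (pos_INR n). pose proof (INR_S_ge1 n).
  assert (0 < / (INR n + 1)) by (apply Rinv_0_lt_compat; lra).
  assert (0 < / (INR n + 3)) by (apply Rinv_0_lt_compat; lra).
  assert (0 < / (INR n + 1) * / (INR n + 3)) by nra.
  rewrite (Rabs_pos_eq (_ ^ _)) by (apply pow_le; lra). rewrite (Rabs_pos_eq 2), (Rabs_pos_eq (_ * _)) by lra.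
  replace (INR (S n) ^ S M * (2 * (/ (INR n + 1) * / (INR n + 3)))) with (INR (S n) ^ M * 2 * / (INR n + 3)).
  - nra.
  - cbn [pow]. rewrite S_INR. field. lra.
Qed.

(** * The three families *)

Lemma setA_iff N phi : setA (S N) phi <-> ell_infty phi /\ weighted N (diff_iter 2 (S N) phi).
Proof.
  unfold setA. rewrite matrix_in_S1_iff_nuclear. unfold matA, weight.
  replace (S N - 1)%nat with N by lia. reflexivity.
Qed.

Lemma setB_iff N phi : setB (S N) phi <-> ell_infty phi /\ weighted N (diff_iter 1 (S N) phi).
Proof.
  unfold setB. rewrite matrix_in_S1_iff_nuclear. unfold matB, weight.
  replace (S N - 1)%nat with N by lia. reflexivity.
Qed.

Lemma setC_iff N phi : setC (S N) phi <-> ell_infty phi /\ weighted N (diff 2 phi).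
Proof.
  unfold setC. rewrite matrix_in_S1_iff_nuclear. unfold matC, weight.
  replace (S N - 1)%nat with N by lia. reflexivity.
Qed.

Lemma setA_decreasing N : Included (setA (S (S N))) (setA (S N)).
Proof.
  intros phi. unfold In. rewrite !setA_iff. intros [Hb H]. split; auto.
  now apply weighted_descent2.
Qed.

Lemma setB_decreasing N : Included (setB (S (S N))) (setB (S N)).
Proof.
  intros phi. unfold In. rewrite !setB_iff. intros [Hb H]. split; auto.
  now apply weighted_descent1.
Qed.

Lemma setC_decreasing N : Included (setC (S (S N))) (setC (S N)).
Proof.
  intros phi. unfold In. rewrite !setC_iff. intros [Hb H]. split; auto.
  now apply weighted_lower.
Qed.

Lemma setC_setA N : Included (setC (S N)) (setA (S N)).
Proof.
  intros phi. unfold In. rewrite setC_iff, setA_iff. intros [Hb H]. split; auto.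
  rewrite diff_iter_succ. now apply weighted_diff_iter.
Qed.

Lemma setB_setA N : Included (setB (S N)) (setA (S N)).
Proof.
  intros phi. unfold In. rewrite setB_iff, setA_iff. intros [Hb H]. split; auto.
  now apply weighted_diff1_diff2.
Qed.

Lemma setC_succ_setC_2 N : Included (setC (S (S N))) (setC 2).
Proof.
  induction N as [|N IH]; [intros phi H; exact H|].
  intros phi H. apply IH, setC_decreasing, H.
Qed.

Lemma strict_included_witness (X Y : Ensemble (nat -> C)) phi :
  Included X Y -> Y phi -> ~ X phi -> Strict_Included X Y.
Proof. intros HXY HY HX. split; [exact HXY|]. intros E. apply HX. now rewrite E. Qed.

Lemma not_included_witness (X Y : Ensemble (nat -> C)) phi : X phi -> ~ Y phi -> ~ Included X Y.
Proof. intros HX HY HI. exact (HY (HI phi HX)). Qed.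

Lemma oscillating_not_setA N : ~ setA (S (S N)) (oscillating (S N)).
Proof. rewrite setA_iff. intros [_ H]. exact (oscillating_not_weighted _ _ H). Qed.

Lemma reciprocal_bigcap_setA : bigcap_ge1 setA reciprocal.
Proof.
  intros [|m] Hm; [lia|]. apply setA_iff. split; [apply reciprocal_bounded | apply reciprocal_weighted].
Qed.

Lemma reciprocal_not_setC N : ~ setC (S (S N)) reciprocal.
Proof.
  intros H. apply setC_succ_setC_2, setC_iff in H. exact (reciprocal_not_weighted 0 (proj2 H)).
Qed.

Lemma alternating_bigcap_setA : bigcap_ge1 setA alternating.
Proof.
  intros [|m] Hm; [lia|]. apply setA_iff. split; [apply alternating_bounded|].
  apply weighted_0, alternating_diff2.
Qed.

Lemma alternating_bigcap_setC : bigcap_ge1 setC alternating.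
Proof.
  intros [|m] Hm; [lia|]. apply setC_iff. split; [apply alternating_bounded|].
  apply weighted_0, (alternating_diff2 0).
Qed.

Lemma alternating_not_setB N : ~ setB (S N) alternating.
Proof. rewrite setB_iff. intros [_ H]. exact (alternating_not_weighted _ _ H). Qed.

Theorem proposition7p5 :
  (forall N : nat, (1 <= N)%nat ->
     Strict_Included (setA (N + 1)) (setA N) /\
     Strict_Included (setB (N + 1)) (setB N) /\
     Strict_Included (setC (N + 1)) (setC N)) /\
  (forall N : nat, (2 <= N)%nat ->
     Strict_Included (setC N) (setA N) /\
     ~ Included (bigcap_ge1 setA) (setC N)) /\
  (forall N : nat, (1 <= N)%nat ->
     Strict_Included (setB N) (setA N) /\
     ~ Included (bigcap_ge1 setA) (setB N) /\
     ~ Included (bigcap_ge1 setC) (setB N)).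
Proof.
  split; [|split].
  - intros [|N] HN; [lia|]. rewrite Nat.add_1_r.
    pose proof (oscillating_bounded (S N)) as Hb.
    pose proof (oscillating_weighted N) as Hw.
    pose proof (oscillating_not_setA N) as HA.
    split; [|split]; apply (strict_included_witness _ _ (oscillating (S N))).
    + apply setA_decreasing.
    + apply setA_iff. split; [exact Hb | now apply weighted_diff_iter].
    + exact HA.
    + apply setB_decreasing.
    + apply setB_iff. split; [exact Hb | now apply weighted_diff_iter].
    + intros H. apply HA, setB_setA, H.
    + apply setC_decreasing.
    + apply setC_iff. split; [exact Hb | now apply weighted_diff].
    + intros H. apply HA, setC_setA, H.
  - intros [|[|N]] HN; [lia | lia |]. split.
    + apply (strict_included_witness _ _ reciprocal).
      * apply setC_setA.
      * apply reciprocal_bigcap_setA. lia.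
      * apply reciprocal_not_setC.
    + apply (not_included_witness _ _ reciprocal);
        [apply reciprocal_bigcap_setA | apply reciprocal_not_setC].
  - intros [|N] HN; [lia|]. split; [|split].
    + apply (strict_included_witness _ _ alternating).
      * apply setB_setA.
      * apply alternating_bigcap_setA. lia.
      * apply alternating_not_setB.
    + apply (not_included_witness _ _ alternating);
        [apply alternating_bigcap_setA | apply alternating_not_setB].
    + apply (not_included_witness _ _ alternating);
        [apply alternating_bigcap_setC | apply alternating_not_setB].
Qed.
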